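(* Let $A\in\mathbb{R}^{4\times4}$ and suppose that $p:=|\Pi(A)|\ge 24$. Then every neighborhood of $A$ in $\mathbb{R}^{4\times 4}$ contains a principally simple matrix $C$ such that $|\Pi(C)|\ge p$.
   Context: For $A\in\mathbb{R}^{n\times n}$, a real number $\lambda$ is a Pareto eigenvalue of $A$ if there exists $x\in\mathbb{R}^n\setminus\{0\}$ with $x\ge 0$, $Ax-\lambda x\ge 0$ (componentwise) and $\langle x,Ax-\lambda x\rangle=0$; $\Pi(A)$ is the set of Pareto eigenvalues of $A$. For nonempty $J\subseteq\{1,\dots,n\}$, $A_J$ is the principal submatrix indexed by $J$. The matrix $A$ is principally simple if (i) for every nonempty $J$, every real eigenvalue of $A_J$ is algebraically simple, and (ii) for any two distinct nonempty index sets $J\ne K$, the matrices $A_J$ and $A_K$ have no common real eigenvalue. *)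

(* Defs.v *)
From HB Require Import structures.
From mathcomp Require Import all_boot all_order all_algebra.
From mathcomp Require Import all_classical all_reals all_analysis.

Set Implicit Arguments.
Unset Strict Implicit.
Unset Printing Implicit Defensive.

Import Order.TTheory GRing.Theory Num.Theory.
Import numFieldNormedType.Exports.

Local Open Scope classical_set_scope.
Local Open Scope ring_scope.

Definition pareto_eigenvalue (R : realType) (n : nat) (A : 'M[R]_n)
    (lambda : R) : Prop :=
  exists x : 'cV[R]_n,
    let w := A *m x - lambda *: x in
    [/\ x != 0,
        forall i, 0 <= x i ord0,
        forall i, 0 <= w i ord0 &
        \sum_i x i ord0 * w i ord0 = 0].

Definition pareto_spectrum (R : realType) (n : nat) (A : 'M[R]_n) : set R :=
  [set lambda | pareto_eigenvalue A lambda].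

(* The rows and columns are taken in the increasing order of the indices. *)
Definition principal_submx (R : realType) (n : nat) (A : 'M[R]_n)
    (J : {set 'I_n}) : 'M[R]_#|J| :=
  mxsub (fun i : 'I_#|J| => enum_val i) (fun i : 'I_#|J| => enum_val i) A.

Definition principally_simple (R : realType) (n : nat) (A : 'M[R]_n) : Prop :=
  (forall (J : {set 'I_n}) (a : R), J != finset.set0 ->
     eigenvalue (principal_submx A J) a ->
     mup a (char_poly (principal_submx A J)) = 1%N) /\
  (forall J K : {set 'I_n}, J != finset.set0 -> K != finset.set0 -> J != K ->
     ~ exists a : R, eigenvalue (principal_submx A J) a /\
                     eigenvalue (principal_submx A K) a).

(* Main.v *)
Require Import Defs.
From HB Require Import structures.
From mathcomp Require Import all_boot all_order all_algebra.
From mathcomp Require Import all_classical all_reals all_analysis.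
From mathcomp Require Import separable.
From mathcomp Require Import ring lra zify.
Import Order.TTheory GRing.Theory Num.Theory.
Import numFieldNormedType.Exports.
Local Open Scope ring_scope.
Set Implicit Arguments.
Unset Strict Implicit.
Unset Printing Implicit Defensive.

(**
Represent every Pareto eigenvalue [l] by a positive eigenvector [x] of some
[A_J], with [J] of minimal size. If [l] is a simple eigenvalue of [A_J] and the
inequalities [(A x)_i >= 0], [i] outside [J], are strict, then [l] survives every
small perturbation. Otherwise, for [#|J| >= 2], the failure costs something: if
[(A x)_i = 0] then [l] is also an eigenvalue of [A_(J + i)], and a multiple
eigenvalue of [A_J] uses up two of its [#|J|] eigenvalues. The principal
submatrices of a 4x4 matrix have 32 eigenvalues in total. The sign pattern of the
off-diagonal entries alone wastes 5 of them: a column with a negative entry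
wastes its diagonal entry, a pair [i, j] has two positive eigenvectors only if
[A i j] and [A j i] have strictly opposite signs, and it has none at all if both
entries in some other row are negative. Hence, with at least 24 Pareto
eigenvalues, at most 3 are degenerate.

A perturbation of row [i] by [t * w] keeps the eigenpair [(l, x)] as soon as
[w x = 0]. As [row i A] and [e_i] act on the [x]'s with [i] in [J] as an affine
function of [l], any [w] can be corrected so as to keep two eigenpairs, at no
harm for the others; so all the inequalities can be made strict one row after
the other. Next, the multiple eigenvalues are split one at a time: perturbing
row [i] by [alpha * row i A + beta * e_i] moves [det (A_J - l)] by
[t * (alpha * l + beta)] times the [i]-th entry of the left eigenvector. This
fails only if three left eigenvectors have the same support [S], in which case
[A_S] or [A] has too many eigenvalues. This requires one-dimensional eigenspaces;
by minimality of [J] the only exceptions are 2x2 scalar blocks, which count as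
two degeneracies and are perturbed beforehand. The remaining zero entries of the columns
representing diagonal entries are finally made positive. All the Pareto
eigenvalues are then stable, and a generic perturbation is principally simple.
*)

(** * Principal submatrices and their eigenvectors *)

Section RootCounting.
Variables (R : fieldType) (p : {poly R}).

(** The quotient of [p] by the product of the ['X - z], [z] in [s], still vanishes on [d], since
    each factor was divided out only once. *)
Lemma double_roots_count (s d : seq R) :
  p != 0 -> uniq s -> uniq d -> {subset d <= s} -> all (root p) s ->
  (forall z, z \in d -> ('X - z%:P) ^+ 2 %| p) ->
  (size s + size d < size p)%N.
Proof.
move=> p0 us ud ds rs dd.
have [q pE] := uniq_roots_prod_XsubC rs (etrans (uniq_rootsE s) us).
have q0 : q != 0 by apply: contraNneq p0 => q0; rewrite pE q0 mul0r.
have P0 : \prod_(z <- s) ('X - z%:P) != 0 :> {poly R}.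
  by apply: contraNneq p0 => P0; rewrite pE P0 mulr0.
have rq : all (root q) d.
  apply/allP => z zd; rewrite -dvdp_XsubCl XsubC_dvd //.
  have := dd z zd; rewrite -mup_geq // pE mupM // mu_prod_XsubC.
  by rewrite count_uniq_mem // (ds _ zd) addn1.
have := max_poly_roots q0 rq ud.
by rewrite pE size_mul // size_prod_XsubC addnS /= -addnC ltn_add2r.
Qed.

End RootCounting.

Section Padded.
Variables (R : realType) (n : nat).
Implicit Types (A C : 'M[R]_n) (J K : {set 'I_n}) (x : 'cV[R]_n) (l : R).

(* [A_J - l] bordered by an identity block: every principal submatrix is
   handled inside ['M_n], with the same determinant and adjugate. *)
Definition subpad A J l : 'M[R]_n :=
  \matrix_(i, j) if i \in J then (if j \in J then A i j - l *+ (i == j) else 0)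
                 else (i == j)%:R.

(** This is $\det(A_J - X)$, the characteristic polynomial of $A_J$ up to the sign $(-1)^{|J|}$. *)
Definition subpoly A J : {poly R} :=
  \det (\matrix_(i, j) (if i \in J then
                  (if j \in J then (A i j)%:P - 'X *+ (i == j) else 0)
                else (i == j)%:R) : 'M[{poly R}]_n).

Lemma horner_subpoly A J l : (subpoly A J).[l] = \det (subpad A J l).
Proof.
rewrite -horner_evalE -det_map_mx; congr (\det _); apply/matrixP => i j.
rewrite !mxE /= /horner_eval; case: ifP => _; last by rewrite hornerMn hornerE.
by case: ifP => _; rewrite ?horner0 // hornerD hornerN hornerMn hornerX hornerC.
Qed.

(** In each term of the Leibniz formula a row in [J] contributes degree at most 1, and a padding row
    a constant. *)
Lemma size_subpoly A J : (size (subpoly A J) <= #|J|.+1)%N.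
Proof.
rewrite /subpoly /determinant; apply: (big_ind (fun q : {poly R} => (size q <= #|J|.+1)%N)).
- by rewrite size_poly0.
- by move=> p q sp sq; apply: leq_trans (size_polyD _ _) _; rewrite geq_max sp sq.
move=> s _; rewrite -signr_odd; set P := \prod_i _.
have -> : size ((-1) ^+ odd (perm.odd_perm s) * P) = size P.
  by case: (odd _); rewrite ?expr1 ?expr0 ?mulN1r ?mul1r ?size_polyN.
apply: leq_trans (size_poly_prod_leq _ _) _.
rewrite leq_subLR cardT size_enum_ord -addSnnS addSn ltnS.
have nE : (n + #|J| = \sum_(i < n) ((i \in J) + 1))%N.
  by rewrite big_split /= sum1_card card_ord addnC -sum1_card big_mkcond.
rewrite nE.
apply: leq_sum => i _; rewrite mxE; case: ifP => iJ; last first.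
  by rewrite -polyC_natr; apply: leq_trans (size_polyC_leq1 _) _.
case: ifP => _; last by rewrite size_poly0.
apply: leq_trans (size_polyD _ _) _; rewrite geq_max size_polyN.
rewrite (leq_trans (size_polyC_leq1 _)) //=.
by case: (_ == _); rewrite ?mulr0n ?mulr1n ?size_poly0 ?size_polyX.
Qed.

(** A column outside [J] of the padded matrix is a unit vector, which forces [v 0 j = 0]; the
    columns in [J] then give the left eigenvector equation of $A_J$. *)
Lemma subpad_lker A J l (v : 'rV[R]_n) :
  v *m subpad A J l = 0 <->
  (forall j, j \notin J -> v 0 j = 0) /\
  (forall j, j \in J -> (v *m A) 0 j = l * v 0 j).
Proof.
have E j : (v *m subpad A J l) 0 j = \sum_(i in J) v 0 i * (A i j - l *+ (i == j)) *+ (j \in J)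
     + v 0 j *+ (j \notin J).
  rewrite mxE (bigID (mem J)) /=; congr (_ + _).
    by apply: eq_bigr => i iJ; rewrite mxE iJ; case: (j \in J); rewrite ?mulr0.
  case: (boolP (j \in J)) => jJ.
    rewrite big1 // => i iJ; rewrite mxE (negPf iJ).
    by case: eqP => [ij|_]; rewrite ?mulr0 //; move: iJ; rewrite ij jJ.
  rewrite (bigD1 j) //= mxE (negPf jJ) eqxx mulr1 big1 ?addr0 // => i /andP[iJ /negPf ij].
  by rewrite mxE (negPf iJ) ij mulr0.
have F j : (forall j, j \notin J -> v 0 j = 0) -> j \in J ->
    \sum_(i in J) v 0 i * (A i j - l *+ (i == j)) = (v *m A) 0 j - l * v 0 j.
  move=> v0 jJ; rewrite [in RHS]mxE [in RHS](bigID (mem J)) /= [X in _ + X - _]big1; last first.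
    by move=> i /v0 ->; rewrite mul0r.
  rewrite addr0 (eq_bigr (fun i => v 0 i * A i j - v 0 i * (l *+ (i == j)))); last first.
    by move=> i _; rewrite mulrBr.
  rewrite sumrB; congr (_ - _); rewrite (bigD1 j) //= eqxx mulr1n big1 ?addr0 1?mulrC //.
  by move=> i /andP[_ /negPf ->]; rewrite mulr0.
split=> [v0|[v0 vA]].
  have w0 j : j \notin J -> v 0 j = 0.
    move=> jJ; have := E j; rewrite v0 mxE jJ (negPf jJ) mulr1n big1 ?add0r //.
  split=> // j jJ; have := E j; rewrite v0 mxE jJ mulr0n addr0 => /esym.
  by rewrite (eq_bigr _ (fun i _ => mulr1n _)) F // => /eqP; rewrite subr_eq0 => /eqP.
apply/rowP => j; rewrite E !mxE; case: (boolP (j \in J)) => jJ; last first.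
  by rewrite v0 // mul0rn big1 ?addr0.
by rewrite mulr0n addr0 (eq_bigr _ (fun i _ => mulr1n _)) F // vA // subrr.
Qed.

Lemma subpad_tr A J l : (subpad A J l)^T = subpad A^T J l.
Proof.
apply/matrixP => i j; rewrite !mxE (eq_sym j i).
case: (eqVneq i j) => [-> //|ij].
by case: (i \in J); case: (j \in J).
Qed.

Lemma subpad_ker A J l x :
  subpad A J l *m x = 0 <->
  (forall i, i \notin J -> x i 0 = 0) /\
  (forall i, i \in J -> (A *m x) i 0 = l * x i 0).
Proof.
have T i : x^T 0 i = x i 0 by rewrite mxE.
have M i : (x^T *m A^T) 0 i = (A *m x) i 0 by rewrite -trmx_mul mxE.
have := subpad_lker A^T J l x^T; rewrite -subpad_tr -trmx_mul => H.
split=> [Q0|[H1 H2]].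
  have /H[H1 H2] : (subpad A J l *m x)^T = 0 by rewrite Q0 trmx0.
  by split=> i iJ; [rewrite -T H1|rewrite -M H2 ?T].
apply: trmx_inj; rewrite trmx0; apply/H.
by split=> i iJ; rewrite ?M ?T; [apply: H1|apply: H2].
Qed.

(** A bound of Gershgorin type: tested where $|v_j|$ is maximal, the left eigenvector equation
    excludes any eigenvalue above the sum of all the $|A_{ij}|$. *)
Lemma subpoly_neq0 A J : subpoly A J != 0.
Proof.
pose l : R := 1 + \sum_i \sum_j `|A i j|.
suff : \det (subpad A J l) != 0.
  by apply: contraNneq => p0; rewrite -horner_subpoly p0 horner0.
apply/negP => /det0P[v v0 /subpad_lker[vJ vA]].
have [k vk] : exists k, v 0 k != 0.
  by apply/existsP; apply: contraR v0; rewrite negb_exists => /forallP H;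
    apply/eqP/rowP => k; rewrite mxE; apply/eqP; rewrite -[_ == _]negbK.
pose j := [arg max_(j > k) `|v 0 j|]%O.
have jmax i : `|v 0 i| <= `|v 0 j|.
  by rewrite /j; case: arg_maxP => //= i0 _; apply.
have vj : 0 < `|v 0 j| by apply: lt_le_trans (jmax k); rewrite normr_gt0.
have jJ : j \in J by apply: contraLR vj => /vJ ->; rewrite normr0 ltxx.
have l0 : 0 <= l by rewrite addr_ge0 // sumr_ge0 // => i _; rewrite sumr_ge0.
have : l * `|v 0 j| <= (\sum_i `|A i j|) * `|v 0 j|.
  rewrite -{1}(ger0_norm l0) -normrM -vA // mxE mulr_suml.
  apply: le_trans (ler_norm_sum _ _ _) _; apply: ler_sum => i _.
  by rewrite normrM mulrC ler_wpM2l.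
rewrite ler_pM2r // => lA.
have : \sum_i `|A i j| <= \sum_i \sum_j0 `|A i j0|.
  by apply: ler_sum => i _; rewrite (bigD1 j) //= lerDl sumr_ge0.
by move=> /(le_trans lA); rewrite /l gerDr ler10.
Qed.

End Padded.

Section Cofactors.
Variables (R : realType) (n : nat).
Implicit Types (M : 'M[R]_n) (x z : 'cV[R]_n) (r c : 'I_n).

Lemma mulmx_minor M z r c : z c 0 = 0 ->
  row' r (col' c M) *m row' c z = row' r (M *m z).
Proof.
move=> zc; apply/colP => k; rewrite !mxE [RHS](bigD1_ord c) //= zc mulr0 add0r.
by apply: eq_bigr => i _; rewrite !mxE.
Qed.

Lemma cofactor_neq0_ker M z r c :
  cofactor M r c != 0 -> M *m z = 0 -> z c 0 = 0 -> z = 0.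
Proof.
move=> cof Mz zc; have := mulmx_minor M r zc.
have -> : row' r (M *m z) = 0 by rewrite Mz; apply/colP => k; rewrite !mxE.
have U : row' r (col' c M) \in unitmx.
  by rewrite unitmxE unitfE; apply: contraNneq cof => d0; rewrite /cofactor d0 mulr0.
move=> /(congr1 (mulmx (invmx (row' r (col' c M))))); rewrite mulKmx // mulmx0 => z0.
apply/colP => i; rewrite mxE; case: (unliftP c i) => [k|] -> //.
by have /colP/(_ k) := z0; rewrite !mxE.
Qed.

(** Take [r] where a left null vector [y] does not vanish. A null vector of the minor, extended by 0
    at [c], is annihilated by all rows except possibly [r], and then by row [r] too because $yM =
    0$. *)
Lemma ker_cofactor_neq0 M x c : M *m x = 0 -> x c 0 != 0 ->
  (forall z, M *m z = 0 -> z c 0 = 0 -> z = 0) ->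
  exists r, cofactor M r c != 0.
Proof.
move=> Mx xc line.
have dM : \det M = 0.
  apply/eqP; rewrite -det_tr; apply/det0P; exists x^T; last first.
    by rewrite -trmx_mul Mx trmx0.
  by apply: contraNneq xc => x0; rewrite -[x]trmxK x0 trmx0 mxE.
have /eqP/det0P[y y0 yM] := dM.
have [r yr] : exists r, y 0 r != 0.
  apply/existsP; apply: contraR y0; rewrite negb_exists => /forallP H.
  by apply/eqP/rowP => k; rewrite mxE; apply/eqP; rewrite -[_ == _]negbK.
exists r; apply/negP => /eqP cof.
have : \det (row' r (col' c M)) = 0.
  by apply/eqP; move/eqP: cof; rewrite /cofactor mulf_eq0 signr_eq0.
rewrite -det_tr => /eqP/det0P[v v0 vM].
pose z : 'cV[R]_n := \col_i if unlift c i is Some k then v 0 k else 0.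
have zc : z c 0 = 0 by rewrite mxE unlift_none.
have zv : row' c z = v^T by apply/colP => k; rewrite !mxE liftK.
have Mz k : (M *m z) (lift r k) 0 = 0.
  have /colP/(_ k) := mulmx_minor M r zc; rewrite zv -[row' r _]trmxK -trmx_mul vM.
  by rewrite [RHS]mxE => <-; rewrite trmx0 mxE.
have Mz0 : M *m z = 0.
  apply/colP => i; rewrite [RHS]mxE; case: (unliftP r i) => [k|] -> //.
  have : (y *m (M *m z)) 0 0 = 0 by rewrite mulmxA yM mul0mx mxE.
  rewrite mxE (bigD1_ord r) //= big1 ?addr0 => [/eqP|k _]; last by rewrite Mz mulr0.
  by rewrite mulf_eq0 (negPf yr) => /eqP.
move: v0 => /eqP; apply; rewrite -[v]trmxK -zv (line z Mz0 zc).
by apply/rowP => k; rewrite !mxE.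
Qed.

(** The cofactors along row [m] do not involve that row, so the dependence on [t] is exactly affine
    and there is no remainder to estimate. *)
Lemma det_row_perturb M (m : 'I_n) (w : 'rV[R]_n) t :
  \det (\matrix_(i, j) (M i j + (t * w 0 j) *+ (i == m))) =
  \det M + t * \sum_j w 0 j * (\adj M) j m.
Proof.
rewrite (expand_det_row _ m) (expand_det_row M m) mulr_sumr -big_split /=.
apply: eq_bigr => j _; rewrite !mxE eqxx mulr1n mulrDl; congr (_ * _ + _).
  rewrite /cofactor; congr (_ * \det _).
  by apply/matrixP => a b; rewrite !mxE eq_sym (negPf (neq_lift _ _)) addr0.
rewrite mulrA /cofactor; congr (_ * (_ * \det _)).
by apply/matrixP => a b; rewrite !mxE eq_sym (negPf (neq_lift _ _)) addr0.
Qed.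

End Cofactors.

(** * Continuity of determinants and cofactors *)

Section Continuity.
Variables (R : realType) (T : topologicalType).
Implicit Types (f g : T -> R).

Lemma continuous_det n (F : T -> 'M[R]_n) :
  (forall i j, continuous (fun t => F t i j)) -> continuous (fun t => \det (F t)).
Proof.
move=> cF; rewrite /determinant; apply: (@continuous_big R _ +%R 0).
  by move=> p; exact: add_continuous.
move=> s _ t; apply: cvgM; first exact: cvg_cst.
apply: (@continuous_big R _ *%R 1 predT _ T _ (fun i t => F t i (perm.fun_of_perm.body s i))).
  by move=> p; exact: mul_continuous.
by move=> i _; exact: cF.
Qed.

Lemma continuous_cofactor n (F : T -> 'M[R]_n) r c :
  (forall i j, continuous (fun t => F t i j)) -> continuous (fun t => cofactor (F t) r c).
Proof.
move=> cF t; rewrite /cofactor; apply: cvgM; first exact: cvg_cst.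
apply: continuous_det => i j u.
have -> : (fun t => row' r (col' c (F t)) i j) = (fun t => F t (lift r i) (lift c j)).
  by apply/funext => v; rewrite !mxE.
exact: cF.
Qed.

Lemma continuous_gt0_near f t : continuous f -> 0 < f t -> \forall u \near t, 0 < f u.
Proof.
move=> cf ft; have := cf t; move/cvgr_gt => /(_ 0 ft); exact.
Qed.

End Continuity.

Section SubpadContinuity.
Variables (R : realType) (n : nat) (J : {set 'I_n}).

Lemma continuous_subpad (T : topologicalType) (F : T -> 'M[R]_n) (g : T -> R) i j :
  (forall i j, continuous (fun t => F t i j)) -> continuous g ->
  continuous (fun t => subpad (F t) J (g t) i j).
Proof.
move=> cF cg t.
have -> : (fun t => subpad (F t) J (g t) i j) =
  (fun t => if i \in J then (if j \in J then F t i j - g t *+ (i == j) else 0)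
                 else (i == j)%:R).
  by apply/funext => q; rewrite mxE.
case: (i \in J); last exact: cvg_cst.
case: (j \in J); last exact: cvg_cst.
apply: cvgB; first exact: cF.
case: (i == j); last exact: cvg_cst.
exact: cg.
Qed.

Lemma continuous_entry (i j : 'I_n) : continuous (fun C : 'M[R]_n => C i j).
Proof. exact: coord_continuous. Qed.

Lemma continuous_entry_fst (i j : 'I_n) : continuous (fun p : 'M[R]_n * R => p.1 i j).
Proof.
move=> p; apply: (@continuous_comp _ _ _ fst (fun C : 'M[R]_n => C i j)).
  exact: cvg_fst.
exact: continuous_entry.
Qed.

Lemma continuous_subpoly a : continuous (fun C : 'M[R]_n => (subpoly C J).[a]).
Proof.
have -> : (fun C : 'M[R]_n => (subpoly C J).[a]) = (fun C => \det (subpad C J a)).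
  by apply/funext => C; rewrite horner_subpoly.
apply: continuous_det => i j.
apply: (@continuous_subpad 'M[R]_n id (fun=> a) i j continuous_entry) => t.
exact: cst_continuous.
Qed.

Lemma continuous_cofactor_subpad r c :
  continuous (fun p : 'M[R]_n * R => cofactor (subpad p.1 J p.2) r c).
Proof.
apply: continuous_cofactor => i j.
apply: (@continuous_subpad ('M[R]_n * R)%type fst snd i j continuous_entry_fst) => t.
exact: cvg_snd.
Qed.

End SubpadContinuity.

(** * Stable Pareto eigenvalues *)

Section PolynomialSigns.
Variables (R : realType) (p : {poly R}) (l : R).

Lemma horner_near_sign : p.[l] != 0 ->
  exists2 d, 0 < d & forall a, `|a - l| < d -> 0 < p.[l] * p.[a].
Proof.
move=> pl; have cp : continuous (fun a => p.[l] * p.[a]).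
  by move=> a; apply: cvgM; [exact: cvg_cst|exact: continuous_horner].
have : 0 < p.[l] * p.[l] by rewrite -expr2 exprn_even_gt0.
move=> /(continuous_gt0_near cp) /nbhs_ballP[d /= d0 dP].
by exists d => // a al; apply: dP; rewrite /ball /= distrC.
Qed.

Lemma horner_ivt (a b d : R) : `|a - l| < d -> `|b - l| < d -> p.[a] * p.[b] < 0 ->
  exists2 m, `|m - l| < d & root p m.
Proof.
wlog ab : a b / a <= b.
  move=> W; case: (leP a b) => [ab|/ltW ba al bl]; first exact: W.
  by rewrite mulrC; exact: W.
rewrite !ltr_distl => /andP[a1 a2] /andP[b1 b2] pab.
have [m /andP[am mb] rm] : exists2 m, a <= m <= b & root p m.
  case: (ltP p.[a] 0) => pa.
    by apply: poly_ivt => //; rewrite (ltW pa) /=; move: pab; rewrite nmulr_rlt0 // => /ltW.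
  have [m amb rm] : exists2 m, a <= m <= b & root (- p) m.
    apply: poly_ivt => //; rewrite !hornerN oppr_le0 pa oppr_ge0 /=.
    rewrite leNgt; apply: contraTN pab => pb; rewrite -leNgt mulr_ge0 // ltW //.
  by exists m => //; rewrite rootN in rm.
exists m => //; rewrite ltr_distl; apply/andP; split.
  exact: lt_le_trans am.
exact: le_lt_trans mb _.
Qed.

End PolynomialSigns.

(** Write $p = q\,(X - l)$. Simplicity gives $q(l) \ne 0$, so [q] keeps its sign near [l] and [p]
    has opposite signs at $l \pm h$. *)
Lemma simple_root_sign_change (R : realType) (p : {poly R}) (l d : R) :
  root p l -> ~~ (('X - l%:P) ^+ 2 %| p) -> 0 < d ->
  exists a b, [/\ `|a - l| < d, `|b - l| < d & p.[a] * p.[b] < 0].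
Proof.
move=> /factor_theorem[q pE] dp d0.
have ql : q.[l] != 0.
  apply: contraNneq dp => ql; rewrite pE expr2 dvdp_mul2r ?polyXsubC_eq0 //.
  by rewrite dvdp_XsubCl /root ql.
have [d' d'0 qd] := horner_near_sign ql.
pose h := Num.min d d' / 2.
have m0 : 0 < Num.min d d' by rewrite lt_min d0 d'0.
have h0 : 0 < h by rewrite divr_gt0.
have hm : h < Num.min d d' by rewrite ltr_pdivrMr // ltr_pMr // ltr1n.
move: hm; rewrite lt_min => /andP[hd hd'].
have na : `|l - h - l| = h by rewrite addrAC subrr sub0r normrN gtr0_norm.
have nb : `|l + h - l| = h by rewrite addrAC subrr add0r gtr0_norm.
exists (l - h), (l + h); rewrite na nb; split => //.
have := qd (l - h); have := qd (l + h); rewrite na nb => /(_ hd') qb /(_ hd') qa.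
have : 0 < (q.[l] * q.[l + h]) * (q.[l] * q.[l - h]) by rewrite mulr_gt0.
rewrite mulrACA pmulr_rgt0; last by rewrite -expr2 exprn_even_gt0.
rewrite pE !hornerM !hornerXsubC => qq.
have -> : l - h - l = - h by ring.
have -> : l + h - l = h by ring.
by rewrite mulrACA pmulr_rlt0 1?mulrC // mulrN oppr_lt0 mulr_gt0.
Qed.

(** [s] carries the sign of [p] immediately to the right of [l]. The lemma also serves to find
    points near [l] where [p] does not vanish. *)
Lemma nonzero_poly_sign_near (R : realType) (p : {poly R}) (l : R) : p != 0 ->
  exists2 s : R, s != 0 & forall d, 0 < d -> exists2 a, `|a - l| < d & 0 < s * p.[a].
Proof.
move=> p0; have [m [q]] := multiplicity_XsubC p l; rewrite p0 /= => ql pE.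
have [d' d'0 qd] := horner_near_sign ql.
exists q.[l] => // d d0; pose h := Num.min d d' / 2.
have m0 : 0 < Num.min d d' by rewrite lt_min d0 d'0.
have h0 : 0 < h by rewrite divr_gt0.
have hm : h < Num.min d d' by rewrite ltr_pdivrMr // ltr_pMr // ltr1n.
move: hm; rewrite lt_min => /andP[hd hd'].
have nb : `|l + h - l| = h by rewrite addrAC subrr add0r gtr0_norm.
exists (l + h); rewrite ?nb //; rewrite pE hornerM horner_exp hornerXsubC mulrA.
by rewrite mulr_gt0 ?qd ?nb // addrAC subrr add0r exprn_gt0.
Qed.

Lemma continuous_mulN (R : realType) (T : topologicalType) (f g : T -> R) :
  continuous f -> continuous g -> continuous (fun t => - (f t * g t)).
Proof. by move=> cf cg t; apply: cvgN; apply: cvgM; [exact: cf|exact: cg]. Qed.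

Lemma near_forall_in (T : topologicalType) (I : finType) (B : pred I)
    (P : I -> T -> Prop) (t : T) :
  (forall i, B i -> \forall u \near t, P i u) -> \forall u \near t, forall i, B i -> P i u.
Proof.
move=> H; apply: filter_forall => i; case: (boolP (B i)) => Bi; last exact: nearW.
by apply: filterS (H i Bi).
Qed.

Lemma near_and (T : topologicalType) (P Q : T -> Prop) (t : T) :
  (\forall u \near t, P u) -> (\forall u \near t, Q u) -> \forall u \near t, P u /\ Q u.
Proof. exact: filterI. Qed.

Section Robust.
Variables (R : realType) (n : nat).
Implicit Types (A C D : 'M[R]_n) (J : {set 'I_n}) (x : 'cV[R]_n) (l e : R).

(** A Pareto eigenvector with its support made explicit: by complementarity $Ax = lx$ on [J], and
    outside [J] the condition $Ax - lx \ge 0$ reduces to $Ax \ge 0$. *)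
Definition prep A l J x : Prop :=
  [/\ J != finset.set0, forall i, i \in J -> 0 < x i 0,
      forall i, i \notin J -> x i 0 = 0,
      forall i, i \in J -> (A *m x) i 0 = l * x i 0 &
      forall i, i \notin J -> 0 <= (A *m x) i 0].

Lemma prep_pareto A l J x : prep A l J x -> pareto_eigenvalue A l.
Proof.
move=> [/set0Pn[k kJ] xp x0 xA xB]; exists x => w; split.
- by apply: contraTneq (xp k kJ) => ->; rewrite mxE ltxx.
- by move=> i; case: (boolP (i \in J)) => [/xp/ltW//|/x0->].
- move=> i; rewrite !mxE; case: (boolP (i \in J)) => iJ; have := xA i; have := xB i.
    by rewrite !mxE iJ => _ /(_ isT) ->; rewrite subrr.
  by rewrite !mxE iJ x0 // mulr0 subr0 => /(_ isT).
- apply: big1 => i _; case: (boolP (i \in J)) => iJ; last by rewrite x0 // mul0r.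
  by have := xA i iJ; rewrite !mxE => ->; rewrite subrr mulr0.
Qed.

Lemma pareto_prep A l : pareto_eigenvalue A l -> exists J x, prep A l J x.
Proof.
move=> [x [x0 xp wp s0]]; exists [set i | x i 0 != 0]%SET, x.
have w0 i : x i 0 * (A *m x - l *: x) i 0 = 0.
  move: s0 => /eqP; rewrite psumr_eq0 => [/allP/(_ i)|j _]; last exact: mulr_ge0.
  by rewrite mem_index_enum => /(_ isT) /eqP.
split.
- apply: contra_neq x0 => /setP E; apply/colP => i; rewrite mxE.
  by have := E i; rewrite !inE => /negbFE/eqP.
- by move=> i; rewrite inE lt_def => ->; exact: xp.
- by move=> i; rewrite inE => /negPn/eqP.
- move=> i; rewrite inE => xi; have /eqP := w0 i.
  by rewrite mulf_eq0 (negPf xi) /= !mxE subr_eq0 => /eqP.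
- by move=> i; rewrite inE => /negPn/eqP xi; have := wp i; rewrite !mxE xi mulr0 subr0.
Qed.

Lemma prep_ker A l J x : prep A l J x -> subpad A J l *m x = 0.
Proof. by move=> [_ _ x0 xA _]; apply/subpad_ker. Qed.

Lemma subpad_ker_root A l J x : x != 0 -> subpad A J l *m x = 0 -> root (subpoly A J) l.
Proof.
move=> x0 Q0; rewrite /root horner_subpoly -det_tr; apply/det0P; exists x^T.
  by apply: contraNneq x0 => xT; rewrite -[x]trmxK xT trmx0.
by rewrite -trmx_mul Q0 trmx0.
Qed.

Lemma prep_neq0 A l J x : prep A l J x -> x != 0.
Proof.
by move=> [/set0Pn[k kJ] xp _ _ _]; apply: contraTneq (xp k kJ) => ->; rewrite mxE ltxx.
Qed.

Lemma prep_root A l J x : prep A l J x -> root (subpoly A J) l.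
Proof. by move=> Ax; apply: subpad_ker_root (prep_neq0 Ax) (prep_ker Ax). Qed.

(** The tolerance [e] is the same on a whole neighborhood of [C]. The property is therefore open and
    survives all later perturbations. *)
Definition robust e C l : Prop :=
  \forall D \near C, exists2 m, `|m - l| < e & pareto_eigenvalue D m.

Lemma robust_near e C l : robust e C l -> \forall D \near C, robust e D l.
Proof. exact: nbhs_interior. Qed.

(* Once [l] is an eigenvalue of [C_J], column [r] of the adjugate is an
   eigenvector depending continuously on [C] and [l]. *)
Definition good C l J (r : 'I_n) (s : R) : Prop :=
  (forall j, j \in J -> 0 < s * cofactor (subpad C J l) r j) /\
  (forall i, i \notin J -> 0 < \sum_j C i j * (s * cofactor (subpad C J l) r j)).

(** Continuity is needed jointly in the matrix and in [l], because the eigenvalue moves with the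
    matrix. *)
Lemma good_near C l J r s : good C l J r s ->
  \forall p \near (C, l), good p.1 p.2 J r s.
Proof.
move=> [g1 g2].
have c1 j : continuous (fun p : 'M[R]_n * R => s * cofactor (subpad p.1 J p.2) r j).
  by move=> p; apply: cvgM; [exact: cvg_cst|exact: continuous_cofactor_subpad].
have c2 i : continuous (fun p : 'M[R]_n * R =>
    \sum_j p.1 i j * (s * cofactor (subpad p.1 J p.2) r j)).
  apply: (@continuous_big R _ +%R 0).
    by move=> p; exact: add_continuous.
  by move=> j _ p; apply: cvgM; [exact: continuous_entry_fst|exact: c1].
apply: (@near_and ('M[R]_n * R)%type);
  apply: (@near_forall_in ('M[R]_n * R)%type) => i iJ.
- exact: (@continuous_gt0_near R ('M[R]_n * R)%type _ (C, l) (c1 i) (g1 i iJ)).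
- exact: (@continuous_gt0_near R ('M[R]_n * R)%type _ (C, l) (c2 i) (g2 i iJ)).
Qed.

Lemma good_prep C l J r s : J != finset.set0 -> good C l J r s ->
  root (subpoly C J) l -> prep C l J (s *: col r (\adj (subpad C J l))).
Proof.
move=> J0 [g1 g2]; rewrite /root horner_subpoly => /eqP d0.
set u := s *: _; have uE j : u j 0 = s * cofactor (subpad C J l) r j by rewrite !mxE.
have : subpad C J l *m u = 0.
  by rewrite -scalemxAr colE mulmxA mul_mx_adj d0 raddf0 mul0mx scaler0.
move=> /subpad_ker[u0 uA]; split => //.
- by move=> j jJ; rewrite uE g1.
- move=> i iJ; rewrite mxE (eq_bigr (fun j => C i j * (s * cofactor (subpad C J l) r j))).
    exact/ltW/g2.
  by move=> j _; rewrite uE.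
Qed.

(** The radius [d] is fixed before [D]. A sign change at [D] persists nearby and yields an
    eigenvalue whose adjugate column is still a Pareto eigenvector. This covers a multiple [l] as
    well: the sign change may appear only at the perturbed matrix [D]. *)
Lemma good_sign_change_robust e C l J r s : J != finset.set0 -> good C l J r s -> 0 < e ->
  exists2 d, 0 < d & \forall D \near C,
    forall a b, `|a - l| < d -> `|b - l| < d ->
      (subpoly D J).[a] * (subpoly D J).[b] < 0 -> robust e D l.
Proof.
move=> J0 /good_near[[V W] [/= nV /nbhs_ballP[d /= d0 dW]] VW] e0.
exists (Num.min d e); first by rewrite lt_min d0 e0.
apply: filterS (nbhs_interior nV) => D DV a b al bl ab.
have nab : \forall E \near D, (subpoly E J).[a] * (subpoly E J).[b] < 0.
  have ce : continuous (fun E : 'M[R]_n => - ((subpoly E J).[a] * (subpoly E J).[b])).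
    by apply: continuous_mulN; exact: continuous_subpoly.
  have := @continuous_gt0_near R _ _ D ce; rewrite oppr_gt0 => /(_ ab).
  by apply: filterS => E; rewrite oppr_gt0.
apply: filterS2 DV nab => E EV Eab.
have [m ml rm] := horner_ivt al bl Eab; move: ml; rewrite lt_min => /andP[md me].
exists m => //; apply: prep_pareto; apply: good_prep J0 _ rm.
by apply: (VW (E, m)); split => //=; apply: dW; rewrite /ball /= distrC.
Qed.

Lemma good_robust e C l J r s : J != finset.set0 -> good C l J r s -> 0 < e ->
  root (subpoly C J) l -> ~~ (('X - l%:P) ^+ 2 %| subpoly C J) -> robust e C l.
Proof.
move=> J0 gC e0 rC dC; have [d d0 H] := good_sign_change_robust J0 gC e0.
have [a [b [al bl ab]]] := simple_root_sign_change rC dC d0.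
exact: (nbhs_singleton H a b).
Qed.

End Robust.

(** The nonzero cofactor makes the kernel the line through [x], and since the determinant vanishes
    all columns of the adjugate lie in it. *)
Lemma cofactor_proportional (R : realType) n (M : 'M[R]_n) (x : 'cV[R]_n) r c :
  M *m x = 0 -> cofactor M r c != 0 -> x c 0 != 0 ->
  forall m, exists h, forall j, cofactor M m j = h * x j 0.
Proof.
move=> Mx cof xc m; exists (cofactor M m c / x c 0) => j.
have dM : \det M = 0.
  apply/eqP; rewrite -det_tr; apply/det0P; exists x^T; last by rewrite -trmx_mul Mx trmx0.
  by apply: contraNneq xc => x0; rewrite -[x]trmxK x0 trmx0 mxE.
pose z := col m (\adj M) - (cofactor M m c / x c 0) *: x.
have Mz : M *m z = 0.
  by rewrite mulmxBr -scalemxAr Mx scaler0 subr0 colE mulmxA mul_mx_adj dM raddf0 mul0mx.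
have zc : z c 0 = 0 by rewrite !mxE divfK // subrr.
have /colP/(_ j) := cofactor_neq0_ker cof Mz zc.
by rewrite !mxE => /eqP; rewrite subr_eq0 => /eqP.
Qed.

(** * Representations of minimal size *)

Section MinimalRepresentation.
Variables (R : realType) (n : nat) (A : 'M[R]_n) (l : R).
Implicit Types (J : {set 'I_n}) (x y z : 'cV[R]_n).

Definition minrep J x : Prop :=
  prep A l J x /\ forall J' x', prep A l J' x' -> (#|J| <= #|J'|)%N.

Lemma exists_minrep : pareto_eigenvalue A l -> exists J x, minrep J x.
Proof.
move=> /pareto_prep[J0 [x0 P0]].
have ex : exists k, `[< exists J x, prep A l J x /\ #|J| = k >].
  by exists #|J0|; apply/asboolP; exists J0, x0.
case: (ex_minnP ex) => k /asboolP[J [x [P Jk]]] kmin.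
exists J, x; split => // J' x' P'; rewrite Jk; apply: kmin.
by apply/asboolP; exists J', x'.
Qed.

(** The support may be smaller than [J]: where [x] vanishes inside [J], the eigenvector equation
    gives $(Ax)_i = 0$, which is allowed outside a support. *)
Lemma nonneg_ker_prep J x : x != 0 -> (forall i, 0 <= x i 0) ->
  subpad A J l *m x = 0 -> (forall i, i \notin J -> 0 <= (A *m x) i 0) ->
  prep A l [set i | x i 0 != 0]%SET x.
Proof.
move=> x0 xp /subpad_ker[xJ xA] xB; split.
- apply: contra_neq x0 => /setP E; apply/colP => i; rewrite mxE.
  by have := E i; rewrite !inE => /negbFE/eqP.
- by move=> i; rewrite inE lt_def => ->; exact: xp.
- by move=> i; rewrite inE => /negPn/eqP.
- move=> i; rewrite inE => xi; apply: xA; apply: contraNT xi => /xJ ->; exact: eqxx.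
- move=> i; rewrite inE => /negPn/eqP xi; case: (boolP (i \in J)) => iJ; last exact: xB.
  by rewrite xA // xi mulr0.
Qed.

Lemma minrep_ker_pos J x y : minrep J x -> y != 0 -> (forall i, 0 <= y i 0) ->
  subpad A J l *m y = 0 -> (forall i, i \notin J -> 0 <= (A *m y) i 0) ->
  forall i, i \in J -> y i 0 != 0.
Proof.
move=> [_ Jmin] y0 yp yk yB i iJ; have := Jmin _ _ (nonneg_ker_prep y0 yp yk yB).
apply: contraTneq => yi; rewrite -ltnNge; apply: proper_card; apply/properP; split.
  apply/fintype.subsetP => j; rewrite inE; apply: contraNT => jJ.
  by have [-> // _] := (subpad_ker A J l y).1 yk.
by exists i; rewrite // inE yi eqxx.
Qed.

(** A nonzero [z] could be added to [x] until some coordinate vanishes, against minimality. At most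
    one index lies outside [J], so the sign of [z] can be chosen to keep the inequality there. *)
Lemma minrep_ker_line J x c : minrep J x -> (n <= #|J|.+1)%N -> c \in J ->
  forall z, subpad A J l *m z = 0 -> z c 0 = 0 -> z = 0.
Proof.
move=> mJ nJ cJ z zk zc; apply/eqP/negPn/negP => z0.
have {z zk zc z0} [z [zk zc z0 zB]] : exists z : 'cV[R]_n,
    [/\ subpad A J l *m z = 0, z c 0 = 0, z != 0 &
    forall i, i \notin J -> 0 <= (A *m z) i 0].
  case: (pselect (forall i, i \notin J -> 0 <= (A *m z) i 0)) => [zB|]; first by exists z.
  move=> /existsNP[i0 /not_implyP[i0J /negP]]; rewrite -ltNge => zi0.
  exists (- z); split; rewrite ?mulmxN ?zk ?oppr0 ?oppr_eq0 ?mxE ?zc ?oppr0 //.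
  move=> i iJ; suff -> : i = i0 by rewrite mxE oppr_ge0 ltW.
  have : (#|~: J| <= 1)%N by rewrite cardsCs finset.setCK card_ord leq_subLR addn1.
  by move=> /card_le1_eqP; apply; rewrite inE /= ?iJ ?i0J.
have [[J0 xp x0 xA xB] _] := mJ.
case: (pselect (forall i, 0 <= z i 0)) => [zp|].
  by have := minrep_ker_pos mJ z0 zp zk zB cJ; rewrite zc eqxx.
move=> /existsNP[k0 /negP]; rewrite -ltNge => zk0.
have negJ i : z i 0 < 0 -> i \in J.
  by apply: contraTT => iJ; have [-> // _] := (subpad_ker A J l z).1 zk; rewrite ltxx.
(* [k] is the first coordinate to vanish on the ray [x + s *: z], while coordinate [c] stays equal
   to [x c 0]. *)
pose k := [arg min_(i < k0 | z i 0 < 0) (x i 0 / - z i 0)]%O.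
have [zkn kmin] : z k 0 < 0 /\ forall i, z i 0 < 0 -> x k 0 / - z k 0 <= x i 0 / - z i 0.
  by rewrite /k; case: arg_minP.
pose s := x k 0 / - z k 0.
have s0 : 0 < s by rewrite divr_gt0 ?oppr_gt0 // xp // negJ.
have kJ := negJ _ zkn.
have yk : (x + s *: z) k 0 = 0.
  by rewrite !mxE /s invrN mulrN mulNr divfK ?subrr // lt_eqF.
have xk : subpad A J l *m x = 0 by apply/subpad_ker.
suff /(_ k kJ) : forall i, i \in J -> (x + s *: z) i 0 != 0 by rewrite yk eqxx.
apply: (minrep_ker_pos mJ).
- apply: contraTneq (xp c cJ) => /colP/(_ c); rewrite !mxE zc mulr0 addr0 => ->.
  by rewrite ltxx.
- move=> i; rewrite !mxE; case: (ltP (z i 0) 0) => zi.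
    have := kmin i zi; rewrite ler_pdivlMr ?oppr_gt0 // -/s mulrN => H.
    by rewrite -[_ * _]opprK subr_ge0.
  apply: addr_ge0; last by rewrite mulr_ge0 // ltW.
  by case: (boolP (i \in J)) => [/xp/ltW//|/x0 ->].
- by rewrite mulmxDr -scalemxAr zk xk scaler0 addr0.
- move=> i iJ; rewrite mulmxDr -scalemxAr !mxE.
  by have := xB i iJ; have := zB i iJ; rewrite !mxE => z1 x1; rewrite addr_ge0 // mulr_ge0 // ltW.
Qed.

Definition scalar_block (J : {set 'I_n}) :=
  [forall i in J, forall j in J, A i j == l *+ (i == j)].

(** A nonzero kernel vector vanishing at [c] makes the other column of $A_J - l$ zero; the equations
    of the positive [x] then make column [c] zero as well, and the block is scalar. *)
Lemma pair_ker_line J x c : prep A l J x -> #|J| = 2%N -> ~~ scalar_block J -> c \in J ->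
  forall z, subpad A J l *m z = 0 -> z c 0 = 0 -> z = 0.
Proof.
move=> [J0 xp x0 xA xB] J2 nsc cJ z zk zc.
have [d dJ] : exists d, J = [set c; d]%SET /\ d != c.
  have /cards2P[a [b [ab JE]]] := introT eqP J2.
  move: cJ; rewrite JE !inE => /orP[]/eqP->; first by exists b; rewrite eq_sym.
  by exists a; rewrite finset.setUC.
case: dJ => JE dc; have dJ : d \in J by rewrite JE !inE eqxx orbT.
have [zJ zA] := (subpad_ker A J l z).1 zk.
have zE i (B : 'M[R]_n) : (B *m z) i 0 = B i d * z d 0.
  rewrite mxE (bigD1 d) //= big1 ?addr0 // => j jd.
  case: (eqVneq j c) => [->|jc]; first by rewrite zc mulr0.
  by rewrite zJ ?mulr0 // JE !inE negb_or jc.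
have xE i : (A *m x) i 0 = A i c * x c 0 + A i d * x d 0.
  rewrite mxE (bigD1 c) //= (bigD1 d) //= big1 ?addr0 // => j /andP[jc jd].
  by rewrite x0 ?mulr0 // JE !inE negb_or jc.
case: (eqVneq (z d 0) 0) => zd.
  apply/colP => i; rewrite mxE; case: (eqVneq i c) => [->//|ic].
  case: (eqVneq i d) => [->//|id]; by rewrite zJ // JE !inE negb_or ic.
have Acd : A c d = 0.
  by have := zA c cJ; rewrite zE zc mulr0 => /eqP; rewrite mulf_eq0 (negPf zd) orbF => /eqP.
have Add : A d d = l by have := zA d dJ; rewrite zE => /(mulIf zd).
have xc0 : x c 0 != 0 by rewrite gt_eqF // xp.
have Acc : A c c = l by have := xA c cJ; rewrite xE Acd mul0r addr0 => /(mulIf xc0).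
have Adc : A d c = 0.
  have := xA d dJ; rewrite xE Add => /eqP; rewrite -subr_eq0 addrK mulf_eq0 (negPf xc0) orbF.
  by move=> /eqP.
case/negP: nsc; apply/forall_inP => i; rewrite JE !inE => /orP[]/eqP->;
  apply/forall_inP => j; rewrite !inE => /orP[]/eqP->;
  by rewrite ?eqxx 1?[c == d]eq_sym ?(negPf dc) ?Acc ?Acd ?Adc ?Add.
Qed.

Lemma prep_column J x r c : prep A l J x -> c \in J ->
  cofactor (subpad A J l) r c != 0 ->
  exists s, forall j, s * cofactor (subpad A J l) r j = x j 0.
Proof.
move=> P cJ cof; have xc : x c 0 != 0 by rewrite gt_eqF //; case: P => _ ->.
have [h hE] := cofactor_proportional (prep_ker P) cof xc r.
exists h^-1 => j; rewrite hE mulKf //.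
by apply: contraNneq cof => h0; rewrite hE h0 mul0r.
Qed.

Lemma prep_good J x r c : prep A l J x -> (forall i, i \notin J -> 0 < (A *m x) i 0) ->
  c \in J -> cofactor (subpad A J l) r c != 0 -> exists s, good A l J r s.
Proof.
move=> P ext cJ cof; have [s sE] := prep_column P cJ cof; exists s.
case: P => _ xp _ _ _; split=> [j jJ|i iJ]; first by rewrite sE xp.
rewrite (eq_bigr (fun j => A i j * x j 0)) => [|j _]; rewrite ?sE //.
by have := ext i iJ; rewrite mxE.
Qed.

End MinimalRepresentation.

(** * Supports with one or two indices *)

Section SmallSupports.
Variables (R : realType) (n : nat) (A : 'M[R]_n).
Implicit Types (l m : R) (J K : {set 'I_n}) (x y z : 'cV[R]_n) (a b i k : 'I_n).

Lemma prep_single k : (forall i, i != k -> 0 <= A i k) ->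
  prep A (A k k) [set k]%SET (delta_mx k 0).
Proof.
move=> Ak; have AE i : (A *m delta_mx k (0 : 'I_1)) i 0 = A i k by rewrite -colE mxE.
split.
- by apply/set0Pn; exists k; rewrite inE.
- by move=> i; rewrite inE => /eqP ->; rewrite mxE !eqxx.
- by move=> i; rewrite inE mxE => /negPf ->.
- by move=> i; rewrite inE => /eqP ->; rewrite AE mxE !eqxx mulr1.
- by move=> i; rewrite inE AE; exact: Ak.
Qed.

Lemma mulmx_pair a b x i : a != b -> (forall j, j \notin [set a; b]%SET -> x j 0 = 0) ->
  (A *m x) i 0 = A i a * x a 0 + A i b * x b 0.
Proof.
move=> ab x0; rewrite mxE (bigD1 a) //= (bigD1 b) 1?eq_sym //= big1 ?addr0 //.
by move=> j /andP[ja jb]; rewrite x0 ?mulr0 // !inE negb_or ja.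
Qed.

Lemma prep_pair l a b x : a != b -> prep A l [set a; b]%SET x ->
  [/\ 0 < x a 0, 0 < x b 0, (l - A a a) * x a 0 = A a b * x b 0 &
      (l - A b b) * x b 0 = A b a * x a 0].
Proof.
move=> ab [_ xp x0 xA _]; split; try by apply: xp; rewrite !inE eqxx ?orbT.
  by have := xA a; rewrite !inE eqxx => /(_ isT); rewrite (mulmx_pair _ ab x0) => E; lra.
by have := xA b; rewrite !inE eqxx orbT => /(_ isT); rewrite (mulmx_pair _ ab x0) => E; lra.
Qed.

Lemma prep_pair_char l a b x : a != b -> prep A l [set a; b]%SET x ->
  (l - A a a) * (l - A b b) = A a b * A b a.
Proof.
move=> ab /(prep_pair ab)[xa xb e1 e2].
apply: (mulIf (lt0r_neq0 xa)); apply: (mulIf (lt0r_neq0 xb)).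
transitivity ((l - A a a) * x a 0 * ((l - A b b) * x b 0)); first by ring.
by rewrite e1 e2; ring.
Qed.

Definition sameneg a b := (A a b < 0) == (A b a < 0).

Lemma prep_pair_sign l a b x : a != b -> sameneg a b -> prep A l [set a; b]%SET x ->
  if A a b < 0 then (l - A a a < 0) && (l - A b b < 0)
  else (0 <= l - A a a) && (0 <= l - A b b).
Proof.
move=> ab sab /(prep_pair ab)[xa xb e1 e2].
have s1 : (l - A a a < 0) = (A a b < 0) by rewrite -(pmulr_llt0 _ xa) e1 pmulr_llt0.
have s2 : (l - A b b < 0) = (A b a < 0) by rewrite -(pmulr_llt0 _ xb) e2 pmulr_llt0.
by rewrite !leNgt s1 s2 -(eqP sab); case: (_ < 0).
Qed.

(** Both values solve the same quadratic equation. If distinct, they add up to the trace; but equal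
    signs put both of them on the same side of the two diagonal entries. *)
Lemma pair_unique l m a b x y : a != b -> sameneg a b ->
  prep A l [set a; b]%SET x -> prep A m [set a; b]%SET y -> l = m.
Proof.
move=> ab sab px py; have := prep_pair_char ab px; rewrite -(prep_pair_char ab py).
have := prep_pair_sign ab sab px; have := prep_pair_sign ab sab py.
move: (A a a) (A b b) => u v Hm Hl E.
have : (m - l) * ((l - u) + (m - v)) = 0 by lra.
move/eqP; rewrite mulf_eq0 subr_eq0 => /orP[/eqP//|/eqP s0].
by move: Hm Hl; case: ifP => _ /andP[h1 h2] /andP[h3 h4]; lra.
Qed.

(** Let [m] be the trace minus [l]. If $m = l$, the signs force both diagonal entries to be [l], and
    the off-diagonal ones vanish. If $m \ne l$, an eigenvector for [m] would give a quadratic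
    polynomial three roots with multiplicity. *)
Lemma pair_double_scalar l a b x : a != b -> sameneg a b ->
  prep A l [set a; b]%SET x -> ('X - l%:P) ^+ 2 %| subpoly A [set a; b]%SET ->
  scalar_block A l [set a; b]%SET.
Proof.
move=> ab sab px dbl; have ch := prep_pair_char ab px; have sg := prep_pair_sign ab sab px.
have [xa xb e1 e2] := prep_pair ab px.
have fin : l = A a a -> l = A b b -> scalar_block A l [set a; b]%SET.
  move=> ea eb; move: e1 e2; rewrite {1}ea {1}eb !subrr !mul0r => /esym/eqP.
  rewrite mulf_eq0 (gt_eqF xb) orbF => /eqP Aab /esym/eqP.
  rewrite mulf_eq0 (gt_eqF xa) orbF => /eqP Aba.
  apply/forall_inP => i; rewrite !inE => /orP[]/eqP->;
    apply/forall_inP => j; rewrite !inE => /orP[]/eqP->;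
    by rewrite ?eqxx 1?[b == a]eq_sym ?(negPf ab) ?Aab ?Aba -?ea -?eb.
pose m := A a a + A b b - l.
case: (eqVneq m l) => [ml|ml].
  have s0 : (l - A a a) + (l - A b b) = 0 by rewrite -{1}ml /m; ring.
  by move: sg; case: ifP => _ /andP[s1 s2]; apply: fin; lra.
have key y : (forall j, j \notin [set a; b]%SET -> y j 0 = 0) -> y != 0 ->
    (l - A b b) * y a 0 + A a b * y b 0 = 0 -> A b a * y a 0 + (l - A a a) * y b 0 = 0 ->
    scalar_block A l [set a; b]%SET.
  move=> y0 yn r1 r2; exfalso.
  have rm : root (subpoly A [set a; b]%SET) m.
    apply: (subpad_ker_root yn); apply/subpad_ker; split=> // i.
    by rewrite !inE (mulmx_pair _ ab y0) /m => /orP[]/eqP->; lra.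
  have := @double_roots_count R _ [:: l; m] [:: l] (subpoly_neq0 A [set a; b]%SET).
  rewrite /= inE eq_sym ml (prep_root px) rm => /(_ isT isT).
  have sub : {subset [:: l] <= [:: l; m]} by move=> u; rewrite !inE => ->.
  have dd : forall u, u \in [:: l] -> ('X - u%:P) ^+ 2 %| subpoly A [set a; b]%SET.
    by move=> u; rewrite inE => /eqP ->.
  move=> /(_ sub isT dd); have := size_subpoly A [set a; b]%SET.
  by rewrite cards2 ab => s3 /leq_trans /(_ s3).
(* By Cayley-Hamilton the columns [y1], [y2] of $l - A_J$ are eigenvectors for [m] unless they
   vanish; if both vanish the block is scalar. *)
pose y1 : 'cV[R]_n := \col_j (if j == a then - A a b else if j == b then l - A b b else 0).
pose y2 : 'cV[R]_n := \col_j (if j == a then l - A a a else if j == b then - A b a else 0).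
have ba : b == a = false by rewrite eq_sym (negPf ab).
have off (u v : R) j : j \notin [set a; b]%SET ->
    (if j == a then u else if j == b then v else 0) = 0.
  by rewrite !inE negb_or => /andP[/negPf-> /negPf->].
case: (eqVneq y1 0) => [/colP y10|y1n]; last first.
  apply: (key y1 _ y1n); first by move=> j jJ; rewrite mxE off.
    by rewrite !mxE eqxx ba eqxx; ring.
  by rewrite !mxE eqxx ba eqxx ch; ring.
case: (eqVneq y2 0) => [/colP y20|y2n]; last first.
  apply: (key y2 _ y2n); first by move=> j jJ; rewrite mxE off.
    by rewrite !mxE eqxx ba eqxx mulrC ch; ring.
  by rewrite !mxE eqxx ba eqxx; ring.
have := y10 b; have := y20 a; rewrite !mxE eqxx ba eqxx => h1 h2.
by apply: fin; lra.
Qed.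

(** A Perron-Frobenius comparison: subtract from [x] the largest multiple of [y] that leaves it
    nonnegative. Where the difference vanishes, its image under [A] is nonnegative, yet equal to $(l
    - m) x_k < 0$. *)
Lemma metzler_unique K l m x y :
  (forall i j, i \in K -> j \in K -> i != j -> 0 <= A i j) ->
  prep A l K x -> prep A m K y -> l = m.
Proof.
move=> AK; wlog lm : l m x y / l < m.
  move=> W px py; case: (ltgtP l m) => // lm; first exact: (W l m x y).
  exact/esym/(W m l y x).
move=> [/set0Pn[k0 k0K] xp x0 xA _] [_ yp y0 yA _]; exfalso.
pose k := [arg min_(i < k0 | i \in K) (x i 0 / y i 0)]%O.
have [kK kmin] : k \in K /\ forall i, i \in K -> x k 0 / y k 0 <= x i 0 / y i 0.
  by rewrite /k; case: arg_minP.
pose t := x k 0 / y k 0.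
have tk : t * y k 0 = x k 0 by rewrite /t divfK // gt_eqF // yp.
have : (A *m (x - t *: y)) k 0 = (l - m) * x k 0.
  by rewrite mulmxBr -scalemxAr !mxE; have := xA k kK; have := yA k kK;
    rewrite !mxE => -> ->; rewrite mulrCA tk mulrBl.
apply/eqP; rewrite gt_eqF // (@lt_le_trans _ _ 0) ?nmulr_rlt0 ?subr_lt0 ?xp //.
rewrite mxE (bigD1 k) //= !mxE tk subrr mulr0 add0r; apply: sumr_ge0 => j jk.
case: (boolP (j \in K)) => jK; last by rewrite !mxE x0 // y0 // mulr0 subr0 mulr0.
apply: mulr_ge0; first by apply: AK; rewrite // eq_sym.
by rewrite !mxE subr_ge0 -ler_pdivlMr ?yp // kmin.
Qed.

(** Every left vector supported on the pair satisfies the equations of columns [a] and [b]; column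
    [i] adds one linear equation on its two coefficients. *)
Lemma scalar_extension_root l a b i : a != b -> i \notin [set a; b]%SET ->
  scalar_block A l [set a; b]%SET -> root (subpoly A (i |: [set a; b])%SET) l.
Proof.
rewrite !inE negb_or => ab /andP[ia ib] /forall_inP sc.
have sE u v : u \in [set a; b]%SET -> v \in [set a; b]%SET -> A u v = l *+ (u == v).
  by move=> uJ vJ; have /forall_inP/(_ v vJ)/eqP := sc u uJ.
have aJ : a \in [set a; b]%SET by rewrite !inE eqxx.
have bJ : b \in [set a; b]%SET by rewrite !inE eqxx orbT.
have ba : b == a = false by rewrite eq_sym (negPf ab).
have key (u v : R) : (u != 0) || (v != 0) -> u * A a i + v * A b i = 0 ->
    root (subpoly A (i |: [set a; b])%SET) l.
  move=> uv r; rewrite /root horner_subpoly; apply/det0P.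
  pose w : 'rV[R]_n := \row_j (if j == a then u else if j == b then v else 0).
  exists w.
    apply: contraTneq uv => /rowP w0; have := w0 a; have := w0 b.
    by rewrite !mxE !eqxx ba => -> ->; rewrite eqxx.
  have wA j : (w *m A) 0 j = u * A a j + v * A b j.
    rewrite mxE (bigD1 a) //= (bigD1 b) ?ba //= big1 ?addr0.
      by rewrite !mxE !eqxx ba.
    by move=> c /andP[ca cb]; rewrite mxE (negPf ca) (negPf cb) mul0r.
  apply/subpad_lker; split=> j.
    by rewrite !inE !negb_or => /and3P[_ /negPf ja /negPf jb]; rewrite mxE ja jb.
  rewrite !inE wA => /or3P[]/eqP->.
  - by rewrite r mxE (negPf ia) (negPf ib) mulr0.
  - by rewrite !sE // mxE eqxx ba mulr0 addr0 mulrC.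
  - by rewrite !sE // mxE eqxx ba (negPf ab) mulr0 add0r mulrC.
case: (eqVneq (A a i) 0) => [ai|ai].
  by apply: (key 1 0); rewrite ?oner_eq0 // ai mulr0 mul0r addr0.
apply: (key (A b i) (- A a i)); first by rewrite oppr_eq0 ai orbT.
by ring.
Qed.

End SmallSupports.

(** * Counting the degenerate eigenvalues *)

Section Charges.
Variables (R : realType) (n : nat) (A : 'M[R]_n) (L : seq R).
Variables (J : R -> {set 'I_n}) (x : R -> 'cV[R]_n).
Hypothesis uniqL : uniq L.
Hypothesis minL : forall l, l \in L -> minrep A l (J l) (x l).
Implicit Types (l : R) (K : {set 'I_n}) (a b i : 'I_n).

Definition scalar_pair l := (#|J l| == 2%N) && scalar_block A l (J l).

(* A charge of [l] to [K] takes away from [A_K] one place for other Pareto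
   eigenvalues. A scalar block [A_J], [#|J| = 2], is charged to both triples
   containing [J]: their submatrices have [l] as an eigenvalue as well. *)
Definition charge l K : bool :=
  (1 < #|J l|)%N &&
  ([exists i, [&& i \notin J l, K == (i |: J l)%SET &
              ((A *m x l) i 0 == 0) || scalar_pair l]] ||
   [&& K == J l, ('X - l%:P) ^+ 2 %| subpoly A K & ~~ scalar_pair l]).

Definition load K : nat :=
  (count (fun l => J l == K) L + count (fun l => charge l K) L)%N.

Lemma prepL l : l \in L -> prep A l (J l) (x l).
Proof. by move=> /minL[]. Qed.

Lemma charge_root l K : l \in L -> charge l K -> root (subpoly A K) l.
Proof.
move=> lL /andP[J2]; case/orP => [/existsP[i /and3P[iJ /eqP-> /orP[/eqP xi|]]]|
  /and3P[/eqP-> _ _]]; last exact: prep_root (prepL lL).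
  apply: (subpad_ker_root (prep_neq0 (prepL lL))); apply/subpad_ker.
  have [_ _ x0 xA _] := prepL lL; split=> j; rewrite !inE ?negb_or.
    by move=> /andP[_ /x0].
  by case/orP => [/eqP->|/xA//]; rewrite xi x0 // mulr0.
case/andP => /cards2P[a [b [ab JE]]]; rewrite JE in iJ *; exact: scalar_extension_root.
Qed.

(** An [l] counted in both terms of [load] is charged to its own support, hence is a double root. So
    [double_roots_count] applies to the union and the intersection of the two families. *)
Lemma load_le_card K : (load K <= #|K|)%N.
Proof.
rewrite /load -count_predUI -2!size_filter.
have := @double_roots_count R (subpoly A K) [seq l <- L | predU (fun l => J l == K) (charge^~ K) l]
  [seq l <- L | predI (fun l => J l == K) (charge^~ K) l] (subpoly_neq0 A K)
  (filter_uniq _ uniqL) (filter_uniq _ uniqL).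
move=> H; rewrite -ltnS (leq_trans _ (size_subpoly A K)) //; apply: H.
- by move=> l; rewrite !mem_filter /= => /andP[/andP[-> _] ->].
- apply/allP => l; rewrite mem_filter /= => /andP[/orP[/eqP<- lL|ch lL]].
    exact: prep_root (prepL lL).
  exact: charge_root.
move=> l; rewrite mem_filter /= => /andP[/andP[/eqP JK /andP[_ ch]] lL].
case/orP: ch => [/existsP[i /and3P[iJ /eqP KE _]]|/and3P[_ -> //]].
by move: iJ; rewrite JK KE !inE eqxx.
Qed.

(** A charge to [i |: J l] goes to a set with at least three elements, so the load of a pair comes
    from eigenvalues represented on that pair. *)
Lemma load_gt0 K : (0 < load K)%N -> #|K| = 2%N -> exists2 l, l \in L & J l = K.
Proof.
rewrite /load addn_gt0 -!has_count => /orP[/hasP[l lL /eqP JK] _|]; first by exists l.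
move=> /hasP[l lL /andP[J1 /orP[/existsP[i /and3P[iJ /eqP KE _]]|/and3P[/eqP KE _ _]]] K2].
  by move: K2; rewrite KE cardsU1 iJ add1n => -[J2]; rewrite J2 in J1.
by exists l.
Qed.

Lemma load_single k : (0 < load [set k]%SET)%N -> forall i, i != k -> 0 <= A i k.
Proof.
rewrite /load addn_gt0 -!has_count => /orP[/hasP[l lL /eqP JK] i ik|].
  have [_ xp x0 _ xB] := prepL lL.
  have := xB i; rewrite JK inE ik => /(_ isT); rewrite mxE (bigD1 k) //= big1 ?addr0.
    by rewrite pmulr_lge0 // xp // JK inE.
  by move=> j jk; rewrite x0 ?mulr0 // JK inE.
move=> /hasP[l lL /andP[J1 /orP[/existsP[i /and3P[iJ /eqP KE _]]|/and3P[/eqP KE _ _]]]].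
  by have := cards1 k; rewrite KE cardsU1 iJ add1n => -[J0]; rewrite J0 in J1.
by move: J1; rewrite -KE cards1.
Qed.

Lemma load_pair_killed a b i : a != b -> i \notin [set a; b]%SET ->
  A i a < 0 -> A i b < 0 -> load [set a; b]%SET = 0%N.
Proof.
move=> ab iJ ia ib; apply/eqP; rewrite -leqn0 leqNgt; apply/negP => /load_gt0.
rewrite cards2 ab => /(_ erefl)[l lL JK].
have P := prepL lL; rewrite JK in P; have [xa xb _ _] := prep_pair ab P.
case: P => _ _ x0 _ xB; have := xB i iJ; rewrite (mulmx_pair _ _ ab x0).
by apply/negP; rewrite -ltNge; nra.
Qed.

(** [pair_double_scalar] excludes charges to the pair, and [pair_unique] a second eigenvalue. *)
Lemma load_pair_sameneg a b : a != b -> sameneg A a b -> (load [set a; b]%SET <= 1)%N.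
Proof.
move=> ab sab; rewrite /load.
have -> : count (charge^~ [set a; b]%SET) L = 0%N.
  apply/eqP; rewrite -leqn0 leqNgt -has_count; apply/negP => /hasP[l lL].
  case/andP => J1 /orP[/existsP[i /and3P[iJ /eqP KE _]]|/and3P[/eqP KE db nsc]].
    by move: (cards2 a b); rewrite KE cardsU1 iJ add1n ab => -[J2]; rewrite J2 in J1.
  have P := prepL lL; rewrite -KE in P.
  by move: nsc; rewrite /scalar_pair -KE cards2 ab eqxx (pair_double_scalar ab sab P db).
rewrite addn0 -size_filter; set s := seq.filter _ _.
have us : uniq s by exact: filter_uniq.
case E : s => [|l [|m s']] //; exfalso.
have : (l \in s) && (m \in s) by rewrite E !inE !eqxx orbT.
rewrite !mem_filter => /andP[/andP[/eqP Jl lL] /andP[/eqP Jm mL]].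
have Pl := prepL lL; have Pm := prepL mL; rewrite Jl in Pl; rewrite Jm in Pm.
by move: us; rewrite E (pair_unique ab sab Pl Pm) /= inE eqxx.
Qed.

Lemma no_single_rep l k : l \in L -> (1 < #|J l|)%N -> l = A k k ->
  (forall i, i != k -> 0 <= A i k) -> False.
Proof.
move=> lL J1 lE Ak; have [_ /(_ [set k]%SET (delta_mx k 0))] := minL lL.
by rewrite lE => /(_ (prep_single Ak)); rewrite cards1 leqNgt -lE J1.
Qed.

(** All negative off-diagonal entries lie in column [a]. By [metzler_unique] the complement of [a]
    supports at most one eigenvalue, so its load exceeds 2 only through a charge coming from a pair.
    Such a charge forces a zero entry, which makes another pair useless. *)
Lemma load_star a : #|~: [set a]%SET| = 3%N ->
  (forall i j, i != j -> j != a -> 0 <= A i j) ->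
  (load (~: [set a])%SET <= 2)%N \/
  exists b c, [/\ b != a, c != a, b != c & load [set b; c]%SET = 0%N].
Proof.
move=> Ka Apos; set K := (~: [set a])%SET.
have inK i : (i \in K) = (i != a) by rewrite !inE.
have cK : (count (fun l => J l == K) L <= 1)%N.
  rewrite -size_filter; set s := seq.filter _ _.
  have us : uniq s by exact: filter_uniq.
  case E : s => [|l [|m s']] //; exfalso.
  have : (l \in s) && (m \in s) by rewrite E !inE !eqxx orbT.
  rewrite !mem_filter => /andP[/andP[/eqP Jl lL] /andP[/eqP Jm mL]].
  have Pl := prepL lL; have Pm := prepL mL; rewrite Jl in Pl; rewrite Jm in Pm.
  have : l = m.
    by apply: (metzler_unique _ Pl Pm) => i j iK jK ij; apply: Apos; rewrite // -inK.
  by move=> lm; move: us; rewrite E lm /= inE eqxx.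
case: (boolP (has (fun l => charge l K && (J l != K)) L)) => [|/hasPn noch]; last first.
  left; rewrite /load (leq_trans (leq_add (leqnn _) _) (leq_add cK cK)) //.
  apply: (@leq_trans (count (predI (fun l => J l == K) (mem L)) L)).
    rewrite -(eq_in_count (a1 := fun l => charge l K && (l \in L))); last first.
      by move=> l lL; rewrite /= lL andbT.
    apply: sub_count => l /= /andP[ch lL]; rewrite lL andbT.
    by have := noch l lL; rewrite ch /= negbK.
  by apply: sub_count => l /= /andP[].
move=> /hasP[l lL /andP[/andP[J1 ch] JK]]; right.
case/orP: ch => [/existsP[i /and3P[iJ /eqP KE ch]]|/and3P[/eqP KE _ _]]; last first.
  by rewrite KE eqxx in JK.
have /eqP/cards2P[b [c [bc JE]]] : #|J l| = 2%N.
  by have := Ka; rewrite -/K KE cardsU1 iJ add1n => -[].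
have ia : i != a by rewrite -inK KE !inE eqxx.
have ba : b != a by rewrite -inK KE JE !inE eqxx orbT.
have ca : c != a by rewrite -inK KE JE !inE eqxx !orbT.
move: iJ; rewrite JE !inE negb_or => /andP[ib ic].
have P := prepL lL; rewrite JE in P.
(* Here [l] is charged from the pair [b], [c] because $(Ax)_i = 0$, whence [A i b = 0]. An
   eigenvalue represented on [i], [b] would then equal [A i i], which the unit vector at [i]
   represents with a smaller support. *)
exists i, b; split => //; apply/eqP; rewrite -leqn0 leqNgt; apply/negP => /load_gt0.
rewrite cards2 ib => /(_ erefl)[m mL Jm].
case/orP: ch => [/eqP xi|/andP[_ /forall_inP/(_ b)]]; last first.
  rewrite JE !inE eqxx => /(_ isT)/forall_inP/(_ b); rewrite !inE !eqxx mulr1n => /(_ isT)/eqP lE.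
  by apply: (no_single_rep lL J1 (esym lE)) => j jb; apply: Apos.
have [xb xc _ _] := prep_pair bc P.
have Aib : A i b = 0.
  move: xi; case: P => _ _ x0 _ _; rewrite (mulmx_pair _ _ bc x0).
  have := Apos i b ib ba; have := Apos i c ic ca => h1 h2 /eqP.
  have p1 : 0 <= A i b * x l b 0 by rewrite mulr_ge0 // ltW.
  have p2 : 0 <= A i c * x l c 0 by rewrite mulr_ge0 // ltW.
  by rewrite paddr_eq0 // mulf_eq0 (gt_eqF xb) orbF => /andP[/eqP].
have Pm := prepL mL; rewrite Jm in Pm.
have [yi yb + _] := prep_pair ib Pm; rewrite Aib mul0r => /eqP.
rewrite mulf_eq0 (gt_eqF yi) orbF subr_eq0 => /eqP mE.
by apply: (no_single_rep mL _ mE) => [|j ji]; [rewrite Jm cards2 ib|apply: Apos].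
Qed.

End Charges.

(** * Sign patterns and bounds on the loads *)

Section LoadBound.

Definition bits (b0 b1 b2 b3 : bool) : {set 'I_4} :=
  [set i : 'I_4 | nth false [:: b0; b1; b2; b3] i]%SET.

Lemma sum_sets4 (F : {set 'I_4} -> nat) :
  (\sum_(K : {set 'I_4}) F K =
   \sum_(b0 : bool) \sum_(b1 : bool) \sum_(b2 : bool) \sum_(b3 : bool) F (bits b0 b1 b2 b3))%N.
Proof.
rewrite (reindex (fun p : bool * (bool * (bool * bool)) =>
  bits p.1 p.2.1 p.2.2.1 p.2.2.2)) /=; last first.
  exists (fun K : {set 'I_4} => (inord 0 \in K, (inord 1 \in K, (inord 2 \in K, inord 3 \in K)))).
    by move=> [b0 [b1 [b2 b3]]] _; rewrite !inE !inordK.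
  move=> K _; apply/setP => i; rewrite !inE /=.
  by case: i => [[|[|[|[|//]]]] hi] /=; congr (_ \in K); apply/val_inj; rewrite /= inordK.
rewrite -(pair_bigA _ (fun b0 q => F (bits b0 q.1 q.2.1 q.2.2))) /=; apply: eq_bigr => b0 _.
rewrite -(pair_bigA _ (fun b1 q => F (bits b0 b1 q.1 q.2))) /=; apply: eq_bigr => b1 _.
by rewrite -(pair_bigA _ (fun b2 b3 => F (bits b0 b1 b2 b3))).
Qed.

Definition single_bound (x y z : bool) : nat := if [|| x, y | z] then 0%N else 1%N.

(** [x], [y] say whether the two off-diagonal entries of the pair are negative; [k1], [k2] say, for
    each of the two other rows, whether both its entries in the columns of the pair are negative. *)
Definition pair_bound (x y k1 k2 : bool) : nat :=
  if k1 || k2 then 0%N else if x == y then 1%N else 2%N.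

Definition forall_bool (P : pred bool) := P true && P false.

Lemma forall_boolP (P : pred bool) b : forall_bool P -> P b.
Proof. by case/andP; case: b. Qed.

(* [nij] is the sign pattern [A i j < 0]. *)
Definition pattern_bound n01 n02 n03 n10 n12 n13 n20 n21 n23 n30 n31 n32 : nat :=
  (single_bound n10 n20 n30 + single_bound n01 n21 n31 +
  single_bound n02 n12 n32 + single_bound n03 n13 n23 +
  pair_bound n01 n10 (n20 && n21) (n30 && n31) + pair_bound n02 n20 (n10 && n12) (n30 && n32) +
  pair_bound n03 n30 (n10 && n13) (n20 && n23) + pair_bound n12 n21 (n01 && n02) (n31 && n32) +
  pair_bound n13 n31 (n01 && n03) (n21 && n23) + pair_bound n23 n32 (n02 && n03) (n12 && n13))%N.

(** One column has its three off-diagonal entries negative, and no other off-diagonal entry is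
    negative. *)
Definition star x y z u1 u2 u3 u4 u5 u6 u7 u8 u9 :=
  [&& x, y & z] && ~~ [|| u1, u2, u3, u4, u5, u6, u7, u8 | u9].

(** The 4096 patterns are checked by computation. Singletons and pairs offer 16 places, of which at
    least 5 are lost; a star pattern may lose only 4, and [load_star] supplies the fifth loss. *)
Lemma pattern_bound_le n01 n02 n03 n10 n12 n13 n20 n21 n23 n30 n31 n32 :
  (pattern_bound n01 n02 n03 n10 n12 n13 n20 n21 n23 n30 n31 n32 <= 11)%N ||
  ((pattern_bound n01 n02 n03 n10 n12 n13 n20 n21 n23 n30 n31 n32 <= 12)%N &&
  [|| star n10 n20 n30 n01 n02 n03 n12 n13 n21 n23 n31 n32,
      star n01 n21 n31 n10 n12 n13 n02 n03 n20 n23 n30 n32,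
      star n02 n12 n32 n20 n21 n23 n01 n03 n10 n13 n30 n31 |
      star n03 n13 n23 n30 n31 n32 n01 n02 n10 n12 n20 n21]).
Proof.
pose chk n01 n02 n03 n10 n12 n13 n20 n21 n23 n30 n31 n32 :=
  (pattern_bound n01 n02 n03 n10 n12 n13 n20 n21 n23 n30 n31 n32 <= 11)%N ||
  ((pattern_bound n01 n02 n03 n10 n12 n13 n20 n21 n23 n30 n31 n32 <= 12)%N &&
  [|| star n10 n20 n30 n01 n02 n03 n12 n13 n21 n23 n31 n32,
      star n01 n21 n31 n10 n12 n13 n02 n03 n20 n23 n30 n32,
      star n02 n12 n32 n20 n21 n23 n01 n03 n10 n13 n30 n31 |
      star n03 n13 n23 n30 n31 n32 n01 n02 n10 n12 n20 n21]).
have all12 : forall_bool (fun b1 => forall_bool (fun b2 => forall_bool (fun b3 =>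
  forall_bool (fun b4 => forall_bool (fun b5 => forall_bool (fun b6 =>
  forall_bool (fun b7 => forall_bool (fun b8 => forall_bool (fun b9 =>
  forall_bool (fun b10 => forall_bool (fun b11 => forall_bool (fun b12 =>
    chk b1 b2 b3 b4 b5 b6 b7 b8 b9 b10 b11 b12)))))))))))).
  by vm_compute.
by move: all12;
  move=> /(@forall_boolP _ n01); move=> /(@forall_boolP _ n02); move=> /(@forall_boolP _ n03);
  move=> /(@forall_boolP _ n10); move=> /(@forall_boolP _ n12); move=> /(@forall_boolP _ n13);
  move=> /(@forall_boolP _ n20); move=> /(@forall_boolP _ n21); move=> /(@forall_boolP _ n23);
  move=> /(@forall_boolP _ n30); move=> /(@forall_boolP _ n31); move=> /(@forall_boolP _ n32).
Qed.

(** [f], [d], [k], [h], [z] are the loads of the full set, triples, pairs, singletons and empty set,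
    [s] counts the eigenvalues and [c] the charges: $s + c \le 4 + 23$ and $s \ge 24$. *)
Lemma load_arith f z s c d0 d1 d2 d3 D0 D1 D2 D3 h0 h1 h2 h3 H0 H1 H2 H3
    k01 k02 k03 k12 k13 k23 K01 K02 K03 K12 K13 K23 :
  (24 <= s)%N ->
  (f + d3 + (d2 + k01) + (d1 + k02 + (k03 + h0)) +
    (d0 + k12 + (k13 + h1) + (k23 + h2 + (h3 + z))) = s + c)%N ->
  (f <= 4)%N -> (z <= 0)%N ->
  (d0 <= D0)%N -> (d1 <= D1)%N -> (d2 <= D2)%N -> (d3 <= D3)%N ->
  (h0 <= H0)%N -> (h1 <= H1)%N -> (h2 <= H2)%N -> (h3 <= H3)%N ->
  (k01 <= K01)%N -> (k02 <= K02)%N -> (k03 <= K03)%N ->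
  (k12 <= K12)%N -> (k13 <= K13)%N -> (k23 <= K23)%N ->
  (D0 + D1 + D2 + D3 + (H0 + H1 + H2 + H3 + K01 + K02 + K03 + K12 + K13 + K23) <= 23)%N ->
  (c <= 3)%N.
Proof. lia. Qed.

End LoadBound.

Section ChargesBound.
Variables (R : realType) (A : 'M[R]_4) (L : seq R).
Variables (J : R -> {set 'I_4}) (x : R -> 'cV[R]_4).
Hypothesis uniqL : uniq L.
Hypothesis minL : forall l, l \in L -> minrep A l (J l) (x l).

Let T := load A L J x.

Lemma sum_load : (\sum_K T K = size L + \sum_(l <- L) \sum_K charge A J x l K)%N.
Proof.
rewrite /T /load big_split /=; congr (_ + _)%N.
  rewrite -sum1_size (eq_bigr (fun K => \sum_(l <- L) (J l == K))%N); last first.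
    by move=> K _; rewrite -sum1_count big_mkcond.
  rewrite exchange_big /=; apply: eq_bigr => l _.
  by rewrite (bigD1 (J l)) //= eqxx big1 // => K; rewrite eq_sym => /negPf ->.
rewrite exchange_big /=; apply: eq_bigr => K _.
by rewrite -sum1_count big_mkcond.
Qed.

Let o0 : 'I_4 := @Ordinal 4 0 isT.
Let o1 : 'I_4 := @Ordinal 4 1 isT.
Let o2 : 'I_4 := @Ordinal 4 2 isT.
Let o3 : 'I_4 := @Ordinal 4 3 isT.
Let N i j := A i j < 0.

Lemma load_single_bound k a b c : [&& a != k, b != k & c != k] ->
  (T [set k]%SET <= single_bound (N a k) (N b k) (N c k))%N.
Proof.
move=> /and3P[ak bk ck]; rewrite /single_bound.
case: (posnP (T [set k]%SET)) => [->//|T0].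
have := load_single minL T0 => H; rewrite /N !ltNge !H //=.
by have := load_le_card uniqL minL [set k]%SET; rewrite cards1.
Qed.

Lemma load_pair_bound a b c d : [&& a != b, c \notin [set a; b]%SET & d \notin [set a; b]%SET] ->
  (T [set a; b]%SET <= pair_bound (N a b) (N b a) (N c a && N c b) (N d a && N d b))%N.
Proof.
move=> /and3P[ab cab dab]; rewrite /pair_bound; case: ifP.
  case/orP => /andP[n1 n2].
    by rewrite /T (load_pair_killed minL ab cab n1 n2).
  by rewrite /T (load_pair_killed minL ab dab n1 n2).
move=> _; case: ifP => [sab|_]; first exact: load_pair_sameneg.
by have := load_le_card uniqL minL [set a; b]%SET; rewrite cards2 ab.
Qed.

Lemma load_star_bound a b c d : [&& a != b, a != c & a != d] ->
  [&& b != c, b != d & c != d] ->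
  star (N b a) (N c a) (N d a) (N a b) (N a c) (N a d)
       (N b c) (N b d) (N c b) (N c d) (N d b) (N d c) ->
  (T [set b; c; d]%SET <= 2)%N \/
  [\/ T [set b; c]%SET = 0%N, T [set b; d]%SET = 0%N | T [set c; d]%SET = 0%N].
Proof.
move=> /and3P[ab ac ad] /and3P[bc bd cd] /andP[_].
rewrite !negb_or => /and5P[n1 n2 n3 n4 /and5P[n5 n6 n7 n8 n9]].
have K3 : #|[set b; c; d]%SET| = 3%N.
  by rewrite finset.setUC cardsU1 cards2 !inE negb_or bc 2![d == _]eq_sym bd cd.
have KE : (~: [set a])%SET = [set b; c; d]%SET.
  apply/esym/eqP; rewrite finset.eqEcard K3 cardsC1 card_ord leqnn andbT.
  apply/fintype.subsetP => i; rewrite !inE.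
  by case/orP => [/orP[]|] /eqP ->; rewrite eq_sym.
have inK i : (i != a) = [|| i == b, i == c | i == d].
  by have /setP/(_ i) := KE; rewrite !inE orbA.
have Apos i j : i != j -> j != a -> 0 <= A i j.
  rewrite [j != a]inK => ij ja; rewrite leNgt -/(N i j); apply/negP => nij.
  case: (eqVneq i a) => [ia|].
    by case/or3P: ja => /eqP jE; move: nij; rewrite ia jE; apply/negP.
  rewrite inK => iK; case/or3P: iK => /eqP iE; case/or3P: ja => /eqP jE;
    by move: ij nij; rewrite iE jE ?eqxx // => _; apply/negP.
have cK : #|~: [set a]%SET| = 3%N by rewrite KE.
case: (load_star uniqL minL cK Apos) => [|[u [v [ua va uv Tuv]]]]; first by rewrite KE; left.
right; move: uv Tuv; rewrite !inK in ua va.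
case/or3P: ua => /eqP->; case/or3P: va => /eqP->; rewrite ?eqxx // => _;
  rewrite -/(T _) => Tuv; first [by apply: Or31|by apply: Or32|by apply: Or33|
  by apply: Or31; rewrite finset.setUC|by apply: Or32; rewrite finset.setUC|
  by apply: Or33; rewrite finset.setUC].
Qed.

(** The sixteen loads are bounded one by one. For a star pattern, [load_star_bound] lowers by one
    the bound of the triple avoiding the negative column, or of a pair inside it. *)
Theorem charges_le3 : (24 <= size L)%N -> (\sum_(l <- L) \sum_K charge A J x l K <= 3)%N.
Proof.
move=> L24; have E := sum_load; rewrite sum_sets4 !big_bool /= in E.
have b0 : bits false false false false = finset.set0.
  by apply/setP => -[[|[|[|[|//]]]] hi]; rewrite !inE.
have s0 : bits true false false false = [set o0]%SET.
  by apply/setP => -[[|[|[|[|//]]]] hi]; rewrite !inE.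
have s1 : bits false true false false = [set o1]%SET.
  by apply/setP => -[[|[|[|[|//]]]] hi]; rewrite !inE.
have s2 : bits false false true false = [set o2]%SET.
  by apply/setP => -[[|[|[|[|//]]]] hi]; rewrite !inE.
have s3 : bits false false false true = [set o3]%SET.
  by apply/setP => -[[|[|[|[|//]]]] hi]; rewrite !inE.
have p01 : bits true true false false = [set o0; o1]%SET.
  by apply/setP => -[[|[|[|[|//]]]] hi]; rewrite !inE.
have p02 : bits true false true false = [set o0; o2]%SET.
  by apply/setP => -[[|[|[|[|//]]]] hi]; rewrite !inE.
have p03 : bits true false false true = [set o0; o3]%SET.
  by apply/setP => -[[|[|[|[|//]]]] hi]; rewrite !inE.
have p12 : bits false true true false = [set o1; o2]%SET.
  by apply/setP => -[[|[|[|[|//]]]] hi]; rewrite !inE.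
have p13 : bits false true false true = [set o1; o3]%SET.
  by apply/setP => -[[|[|[|[|//]]]] hi]; rewrite !inE.
have p23 : bits false false true true = [set o2; o3]%SET.
  by apply/setP => -[[|[|[|[|//]]]] hi]; rewrite !inE.
have t0 : bits false true true true = [set o1; o2; o3]%SET.
  by apply/setP => -[[|[|[|[|//]]]] hi]; rewrite !inE.
have t1 : bits true false true true = [set o0; o2; o3]%SET.
  by apply/setP => -[[|[|[|[|//]]]] hi]; rewrite !inE.
have t2 : bits true true false true = [set o0; o1; o3]%SET.
  by apply/setP => -[[|[|[|[|//]]]] hi]; rewrite !inE.
have t3 : bits true true true false = [set o0; o1; o2]%SET.
  by apply/setP => -[[|[|[|[|//]]]] hi]; rewrite !inE.
rewrite b0 s0 s1 s2 s3 p01 p02 p03 p12 p13 p23 t0 t1 t2 t3 in E.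
have z0 : (T finset.set0 <= 0)%N by have := load_le_card uniqL minL finset.set0; rewrite cards0.
have c4 : (T (bits true true true true) <= 4)%N.
  by apply: leq_trans (load_le_card uniqL minL _) _; rewrite -[leqRHS](card_ord 4); exact: max_card.
have c3 (a b c : 'I_4) : (T [set a; b; c]%SET <= 3)%N.
  apply: leq_trans (load_le_card uniqL minL _) _.
  by apply: leq_trans (leq_card_setU _ _) _; rewrite cards2 cards1 addn1 ltnS; case: (_ != _).
have d0 := c3 o1 o2 o3; have d1 := c3 o0 o2 o3; have d2 := c3 o0 o1 o3; have d3 := c3 o0 o1 o2.
have h0 := @load_single_bound o0 o1 o2 o3 isT.
have h1 := @load_single_bound o1 o0 o2 o3 isT.
have h2 := @load_single_bound o2 o0 o1 o3 isT.
have h3 := @load_single_bound o3 o0 o1 o2 isT.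
have k01 := @load_pair_bound o0 o1 o2 o3; rewrite !inE in k01; have {}k01 := k01 isT.
have k02 := @load_pair_bound o0 o2 o1 o3; rewrite !inE in k02; have {}k02 := k02 isT.
have k03 := @load_pair_bound o0 o3 o1 o2; rewrite !inE in k03; have {}k03 := k03 isT.
have k12 := @load_pair_bound o1 o2 o0 o3; rewrite !inE in k12; have {}k12 := k12 isT.
have k13 := @load_pair_bound o1 o3 o0 o2; rewrite !inE in k13; have {}k13 := k13 isT.
have k23 := @load_pair_bound o2 o3 o0 o1; rewrite !inE in k23; have {}k23 := k23 isT.
have := pattern_bound_le (N o0 o1) (N o0 o2) (N o0 o3) (N o1 o0) (N o1 o2) (N o1 o3)
  (N o2 o0) (N o2 o1) (N o2 o3) (N o3 o0) (N o3 o1) (N o3 o2).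
rewrite /pattern_bound => H.
case/orP: H => [H|/andP[_ /or4P[] st]].
  by apply: (load_arith L24 E c4 z0 d0 d1 d2 d3 h0 h1 h2 h3 k01 k02 k03 k12 k13 k23);
    rewrite (leq_add2l 12).
- have S := @load_star_bound o0 o1 o2 o3 isT isT st.
  move: st => /andP[/and3P[y1 y2 y3]]; rewrite !negb_or.
  move=> /and5P[/negPf n1 /negPf n2 /negPf n3 /negPf n4].
  move=> /and5P[/negPf n5 /negPf n6 /negPf n7 /negPf n8 /negPf n9].
  rewrite ?y1 ?y2 ?y3 ?n1 ?n2 ?n3 ?n4 ?n5 ?n6 ?n7 ?n8 ?n9 in h0 h1 h2 h3 k01 k02 k03 k12 k13 k23.
  case: S => [t|[]/eq_leq t].
  + by apply: (load_arith L24 E c4 z0 t d1 d2 d3 h0 h1 h2 h3 k01 k02 k03 k12 k13 k23).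
  + by apply: (load_arith L24 E c4 z0 d0 d1 d2 d3 h0 h1 h2 h3 k01 k02 k03 t k13 k23).
  + by apply: (load_arith L24 E c4 z0 d0 d1 d2 d3 h0 h1 h2 h3 k01 k02 k03 k12 t k23).
  + by apply: (load_arith L24 E c4 z0 d0 d1 d2 d3 h0 h1 h2 h3 k01 k02 k03 k12 k13 t).
- have S := @load_star_bound o1 o0 o2 o3 isT isT st.
  move: st => /andP[/and3P[y1 y2 y3]]; rewrite !negb_or.
  move=> /and5P[/negPf n1 /negPf n2 /negPf n3 /negPf n4].
  move=> /and5P[/negPf n5 /negPf n6 /negPf n7 /negPf n8 /negPf n9].
  rewrite ?y1 ?y2 ?y3 ?n1 ?n2 ?n3 ?n4 ?n5 ?n6 ?n7 ?n8 ?n9 in h0 h1 h2 h3 k01 k02 k03 k12 k13 k23.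
  case: S => [t|[]/eq_leq t].
  + by apply: (load_arith L24 E c4 z0 d0 t d2 d3 h0 h1 h2 h3 k01 k02 k03 k12 k13 k23).
  + by apply: (load_arith L24 E c4 z0 d0 d1 d2 d3 h0 h1 h2 h3 k01 t k03 k12 k13 k23).
  + by apply: (load_arith L24 E c4 z0 d0 d1 d2 d3 h0 h1 h2 h3 k01 k02 t k12 k13 k23).
  + by apply: (load_arith L24 E c4 z0 d0 d1 d2 d3 h0 h1 h2 h3 k01 k02 k03 k12 k13 t).
- have S := @load_star_bound o2 o0 o1 o3 isT isT st.
  move: st => /andP[/and3P[y1 y2 y3]]; rewrite !negb_or.
  move=> /and5P[/negPf n1 /negPf n2 /negPf n3 /negPf n4].
  move=> /and5P[/negPf n5 /negPf n6 /negPf n7 /negPf n8 /negPf n9].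
  rewrite ?y1 ?y2 ?y3 ?n1 ?n2 ?n3 ?n4 ?n5 ?n6 ?n7 ?n8 ?n9 in h0 h1 h2 h3 k01 k02 k03 k12 k13 k23.
  case: S => [t|[]/eq_leq t].
  + by apply: (load_arith L24 E c4 z0 d0 d1 t d3 h0 h1 h2 h3 k01 k02 k03 k12 k13 k23).
  + by apply: (load_arith L24 E c4 z0 d0 d1 d2 d3 h0 h1 h2 h3 t k02 k03 k12 k13 k23).
  + by apply: (load_arith L24 E c4 z0 d0 d1 d2 d3 h0 h1 h2 h3 k01 k02 t k12 k13 k23).
  + by apply: (load_arith L24 E c4 z0 d0 d1 d2 d3 h0 h1 h2 h3 k01 k02 k03 k12 t k23).
- have S := @load_star_bound o3 o0 o1 o2 isT isT st.
  move: st => /andP[/and3P[y1 y2 y3]]; rewrite !negb_or.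
  move=> /and5P[/negPf n1 /negPf n2 /negPf n3 /negPf n4].
  move=> /and5P[/negPf n5 /negPf n6 /negPf n7 /negPf n8 /negPf n9].
  rewrite ?y1 ?y2 ?y3 ?n1 ?n2 ?n3 ?n4 ?n5 ?n6 ?n7 ?n8 ?n9 in h0 h1 h2 h3 k01 k02 k03 k12 k13 k23.
  case: S => [t|[]/eq_leq t].
  + by apply: (load_arith L24 E c4 z0 d0 d1 d2 t h0 h1 h2 h3 k01 k02 k03 k12 k13 k23).
  + by apply: (load_arith L24 E c4 z0 d0 d1 d2 d3 h0 h1 h2 h3 t k02 k03 k12 k13 k23).
  + by apply: (load_arith L24 E c4 z0 d0 d1 d2 d3 h0 h1 h2 h3 k01 t k03 k12 k13 k23).
  + by apply: (load_arith L24 E c4 z0 d0 d1 d2 d3 h0 h1 h2 h3 k01 k02 k03 t k13 k23).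
Qed.

End ChargesBound.

(** * Removing the degeneracies *)

Section RowPerturbation.
Variables (R : realType) (n : nat).
Implicit Types (C D N : 'M[R]_n) (i j k : 'I_n) (w : 'rV[R]_n) (x : 'cV[R]_n) (t : R).

Lemma nbhs_direction C N (V : set 'M[R]_n) : nbhs C V ->
  exists2 d, 0 < d & forall t, `|t| < d -> V (C + t *: N).
Proof.
move=> /nbhs_ballP[e /= e0 eV].
pose S := 1 + \sum_i \sum_j `|N i j|.
have S0 : 0 < S by rewrite ltr_pwDl // sumr_ge0 // => i _; rewrite sumr_ge0.
exists (e / S); first by rewrite divr_gt0.
move=> t td; apply: eV; split => // i j; rewrite /ball /= !mxE opprD addrA subrr sub0r normrN.
rewrite normrM (@le_lt_trans _ _ (`|t| * S)) //; last by rewrite -ltr_pdivlMr.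
apply: ler_wpM2l => //; rewrite /S (bigD1 i) //= (bigD1 j) //=.
have p1 : 0 <= \sum_(k < n | k != j) `|N i k| by apply: sumr_ge0.
have p2 : 0 <= \sum_(k < n | k != i) \sum_m `|N k m|.
  by apply: sumr_ge0 => k _; apply: sumr_ge0.
by rewrite addrA ler_wpDr // addrA ler_wpDr // lerDr.
Qed.

Definition row_perturb C i w t : 'M[R]_n :=
  \matrix_(k, j) (C k j + (t * w 0 j) *+ (k == i)).

Lemma row_perturb_near C i w (V : set 'M[R]_n) : nbhs C V ->
  exists2 d, 0 < d & forall t, `|t| < d -> V (row_perturb C i w t).
Proof.
move=> /(@nbhs_direction _ (\matrix_(k, j) (w 0 j *+ (k == i))))[d d0 dV].
exists d => // t /dV; congr (V _); apply/matrixP => k j; rewrite !mxE.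
by rewrite mulrnAr.
Qed.

Lemma row_perturbN C i w t k j : k != i -> row_perturb C i w t k j = C k j.
Proof. by move=> /negPf ki; rewrite mxE ki addr0. Qed.

Lemma row_perturb_mul C i w t x k :
  (row_perturb C i w t *m x) k 0 = (C *m x) k 0 + (t * (w *m x) 0 0) *+ (k == i).
Proof.
rewrite [LHS]mxE [(C *m x) k 0]mxE [(w *m x) 0 0]mxE mulr_sumr -sumrMnl -big_split /=.
by apply: eq_bigr => j _; rewrite mxE mulrDl mulrnAl mulrA.
Qed.

(* Directions along [row i C] and [e_i]: on an eigenvector of eigenvalue [l] they
   act as an affine function of [l], and they do not touch the zeros of row [i]
   off the diagonal. *)
Definition affine_row C i (alpha beta : R) : 'rV[R]_n :=
  alpha *: row i C + beta *: delta_mx 0 i.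

Lemma affine_rowE C i alpha beta j :
  affine_row C i alpha beta 0 j = alpha * C i j + beta *+ (j == i).
Proof. by rewrite !mxE eqxx /= mulr_natr. Qed.

Lemma affine_row_mul C i alpha beta x :
  (affine_row C i alpha beta *m x) 0 0 = alpha * (C *m x) i 0 + beta * x i 0.
Proof. by rewrite mulmxDl -!scalemxAl -row_mul -rowE !mxE. Qed.

End RowPerturbation.

Lemma affine_interpolation (R : fieldType) (s : seq R) (f : R -> R) :
  uniq s -> (size s <= 2)%N ->
  exists alpha beta, forall l, l \in s -> alpha * l + beta = f l.
Proof.
case: s => [|a [|b [|c s]]] //= => [_|_|/andP[ab _]] _.
- by exists 0, 0.
- by exists 0, (f a) => l; rewrite inE => /eqP ->; rewrite mul0r add0r.
have ba : b - a != 0 by rewrite subr_eq0 eq_sym; move: ab; rewrite inE.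
exists ((f b - f a) / (b - a)), (f a - (f b - f a) / (b - a) * a) => l.
rewrite !inE => /orP[]/eqP->; first by rewrite addrC subrK.
by rewrite addrCA -mulrBr divfK // addrC subrK.
Qed.

(** The condition on [1 + t * alpha] serves for nonnegative quantities that a row perturbation
    multiplies by this factor. *)
Lemma small_step (R : realFieldType) (alpha d : R) : 0 < d ->
  exists t, [/\ 0 < t, `|t| < d & 0 <= 1 + t * alpha].
Proof.
move=> d0; pose m := Num.min d (1 + `|alpha|)^-1.
have a1 : 0 < 1 + `|alpha| by rewrite ltr_pwDl.
have m0 : 0 < m by rewrite lt_min d0 invr_gt0.
have t0 : 0 < m / 2 by rewrite divr_gt0.
have H : m / 2 < m by rewrite ltr_pdivrMr // ltr_pMr // ltr1n.
exists (m / 2); move: t0 H; set t := m / 2 => t0.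
rewrite {1}/m lt_min => /andP[td]; rewrite -[X in _ < X]mul1r ltr_pdivlMr // => ta.
split => //; first by rewrite gtr0_norm.
have : t * - alpha <= t * `|alpha| by rewrite ler_wpM2l ?(ltW t0) // -normrN ler_norm.
by move: ta; rewrite mulrDr mulr1 mulrN; lra.
Qed.

Lemma near_all (T : topologicalType) (P : T -> Prop) (t : T) :
  (forall u, P u) -> \forall u \near t, P u.
Proof. exact: nearW. Qed.

Lemma near_all_seq (T : topologicalType) (U : eqType) (s : seq U) (P : U -> T -> Prop) (t : T) :
  (forall l, l \in s -> \forall u \near t, P l u) ->
  \forall u \near t, forall l, l \in s -> P l u.
Proof.
elim: s => [|a s IH] H; first by apply: nearW.
have H1 : \forall u \near t, forall l, l \in s -> P l u.
  by apply: IH => l ls; apply: H; rewrite inE ls orbT.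
apply: filterS2 (H a (mem_head _ _)) H1 => u Pa Ps l.
by rewrite inE => /orP[/eqP->//|/Ps].
Qed.

Lemma dist_near (R : realType) (T : topologicalType) (f : T -> R) (t : T) (l e : R) :
  continuous f -> `|f t - l| < e -> \forall u \near t, `|f u - l| < e.
Proof.
move=> cf; have c : continuous (fun u => e - `|f u - l|).
  move=> u; apply: cvgB; first exact: cvg_cst.
  by apply: cvg_norm; apply: cvgB; [exact: cf|exact: cvg_cst].
rewrite -subr_gt0 => /(continuous_gt0_near c).
by apply: filterS => u; rewrite subr_gt0.
Qed.

Section Phases.
Variables (R : realType) (n : nat) (e : R) (L : seq R).
Variables (J : R -> {set 'I_n}) (x : R -> 'cV[R]_n).
Implicit Types (C : 'M[R]_n) (B : seq R) (V : set 'M[R]_n) (l : R) (i j k : 'I_n).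

(** A diagonal eigenvalue is followed only up to [e]. Zeros are still allowed in its column, so it
    is not yet stable. *)
Definition single_ok C l : Prop := exists k,
  [/\ J l = [set k]%SET, forall i, i != k -> 0 <= C i k & `|C k k - l| < e].

(** [B] lists the degenerate eigenvalues, whose eigenpairs [(l, x l)] are kept exactly. *)
Definition state1 B C : Prop :=
  (forall l, l \in L -> [\/ robust e C l, single_ok C l | l \in B]) /\
  (forall l, l \in B -> prep C l (J l) (x l)).

Lemma diag_near C l k : `|C k k - l| < e ->
  \forall D \near C, `|(D : 'M[R]_n) k k - l| < e.
Proof. by apply: dist_near; exact: continuous_entry. Qed.

(** Nonnegativity of a column is not an open condition: it is recorded at [C], and every
    perturbation has to respect it by its form. *)
Lemma tame_near B C : (forall l, l \in L -> [\/ robust e C l, single_ok C l | l \in B]) ->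
  \forall D \near C, forall l, l \in L -> [\/ robust e D l,
    single_ok C l /\ forall k, J l = [set k]%SET -> `|D k k - l| < e | l \in B].
Proof.
move=> H; apply: near_all_seq => l /H[rl|[k [Jk C0 kl]]|lB].
- by apply: filterS (robust_near rl) => D ?; apply: Or31.
- apply: filterS (diag_near kl) => D Dk; apply: Or32; split; first by exists k.
  by move=> k'; rewrite Jk => /finset.set1_inj <-.
- by apply: (@near_all 'M[R]_n) => D; apply: Or33.
Qed.

(** The all-ones part of [w] pushes $(Cx)_i$ up. The affine part cancels this push on the at most
    two eigenpairs with [i] in [J l]; on the other ones it only multiplies $(Cx)_i \ge 0$ by
    [1 + t * alpha]. *)
Lemma row_step B C V i : uniq B -> (size [seq l <- B | i \in J l] <= 2)%N ->
  state1 B C -> nbhs C V ->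
  exists C', [/\ V C', state1 B C', forall k j, k != i -> C' k j = C k j &
    forall l, l \in B -> i \notin J l -> 0 < (C' *m x l) i 0].
Proof.
move=> uB sB [tame pB] nV.
have [alpha [beta ab]] := @affine_interpolation R [seq l <- B | i \in J l]
  (fun l => - (\sum_j x l j 0) / x l i 0) (filter_uniq _ uB) sB.
pose w := const_mx 1 + affine_row C i alpha beta.
have wE l : (w *m x l) 0 0 = (\sum_j x l j 0) + alpha * (C *m x l) i 0 + beta * x l i 0.
  rewrite mulmxDl mxE affine_row_mul addrA; congr (_ + _ + _).
  by rewrite mxE; apply: eq_bigr => j _; rewrite mxE mul1r.
have [d d0 dV] := row_perturb_near i w (filterI nV (tame_near tame)).
have [t [t0 td ta1]] := small_step alpha d0.
have [VC' tC'] := dV t td.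
set C' := row_perturb C i w t in VC' tC' *.
have sumx l : l \in B -> 0 < \sum_j x l j 0.
  move=> /pB[/set0Pn[k kJ] xp x0 _ _]; rewrite (bigD1 k) //= ltr_pwDl ?xp // sumr_ge0 // => j _.
  by case: (boolP (j \in J l)) => [/xp/ltW//|/x0->].
have ext l : l \in B -> i \notin J l -> 0 < (C' *m x l) i 0.
  move=> lB iJ; have [_ _ x0 _ xB] := pB l lB.
  rewrite row_perturb_mul eqxx mulr1n wE (x0 i iJ) mulr0 addr0 mulrDr addrCA ltr_pwDl //.
    by rewrite mulr_gt0 ?sumx.
  by rewrite mulrA -{1}[(C *m x l) i 0]mul1r -mulrDl mulr_ge0 // xB.
exists C'; split => //; last by move=> k j; exact: row_perturbN.
split.
  move=> l /tC'[rl|[[k [Jk Ck _]] Dk]|lB]; [by apply: Or31| |by apply: Or33].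
  apply: Or32; exists k; split => //; last exact: Dk.
  move=> j jk; rewrite mxE; case: (eqVneq j i) => [ji|ji]; last by rewrite addr0 Ck.
  rewrite mulr1n mxE mxE affine_rowE -ji [k == j]eq_sym (negPf jk) addr0.
  have -> : C j k + t * (1 + alpha * C j k) = (1 + t * alpha) * C j k + t by ring.
  by rewrite addr_ge0 ?mulr_ge0 ?Ck // ltW.
move=> l lB; have [J0 xp x0 xA xB] := pB l lB; split => //.
- move=> k kJ; rewrite row_perturb_mul; case: (eqVneq k i) => [ki|ki]; last by rewrite addr0 xA.
  rewrite mulr1n wE -ki xA // mulrA -addrA -mulrDl.
  rewrite ab; last by rewrite mem_filter -ki kJ.
  by rewrite -ki divfK ?addrN ?mulr0 ?addr0 // gt_eqF // xp.
- move=> k kJ; case: (eqVneq k i) => [ki|ki]; first by rewrite ki ltW // ext // -ki.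
  by rewrite row_perturb_mul (negPf ki) addr0 xB.
Qed.

(** A row lying in every support needs no change. Otherwise one of the at most three supports omits
    it, which leaves at most two eigenpairs to preserve. Rows treated earlier are not modified. *)
Lemma all_rows_step B C V : uniq B -> (size B <= 3)%N -> state1 B C -> nbhs C V ->
  exists C', [/\ V C', state1 B C' &
    forall l i, l \in B -> i \notin J l -> 0 < (C' *m x l) i 0].
Proof.
move=> uB sB SC nV.
suff [C' [VC' SC' ext]] : exists C', [/\ V C', state1 B C' &
    forall l i, i \in enum 'I_n -> l \in B -> i \notin J l -> 0 < (C' *m x l) i 0].
  by exists C'; split => // l i; apply: ext; rewrite mem_enum.
elim: (enum 'I_n) V nV => [|i s IH] V nV; first by exists C; split => //; exact: nbhs_singleton.
have [C1 [VC1 SC1 ext1]] := IH _ (nbhs_interior nV).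
case: (boolP (all (fun l => i \in J l) B)) => [/allP al|].
  exists C1; split => //; first exact: (nbhs_singleton VC1).
  move=> l j; rewrite inE => /orP[/eqP-> lB|js lB]; last exact: ext1.
  by rewrite al.
move=> /allPn[l0 l0B l0J].
have s2 : (size [seq l <- B | i \in J l] <= 2)%N.
  rewrite size_filter -ltnS (leq_trans _ sB) // -(count_predC (fun l => i \in J l) B).
  by rewrite -[X in (X < _)%N]addn0 ltn_add2l -has_count; apply/hasP; exists l0.
have [C2 [VC2 SC2 same ext2]] := row_step uB s2 SC1 VC1.
exists C2; split => // l j; rewrite inE => /orP[/eqP->|js lB jJ]; first exact: ext2.
case: (eqVneq j i) => [ji|ji]; first by rewrite ji ext2 // -ji.
suff -> : (C2 *m x l) j 0 = (C1 *m x l) j 0 by exact: ext1.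
by rewrite !mxE; apply: eq_bigr => k _; rewrite same.
Qed.

End Phases.

Section ScalarStep.
Variables (R : realType) (n : nat) (e : R) (L : seq R).
Variables (J : R -> {set 'I_n}) (x : R -> 'cV[R]_n).

(** Entry [(a, b)] becomes positive, with a correction of the diagonal entry that keeps [x l0]. The
    only other eigenpair is kept by adding a multiple of [row a C] minus [l0] times the unit row at
    [a], which vanishes on [x l0]. *)
Lemma scalar_step (B : seq R) (C : 'M[R]_n) (V : set 'M[R]_n) (l0 : R) (a b : 'I_n) :
  uniq B -> (size B <= 2)%N -> l0 \in B -> a != b -> J l0 = [set a; b]%SET ->
  scalar_block C l0 (J l0) -> (forall l, l \in L -> J l <> [set b]%SET) ->
  state1 e L J x B C -> nbhs C V ->
  exists C', [/\ V C', state1 e L J x B C' & ~~ scalar_block C' l0 (J l0)].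
Proof.
move=> uB sB l0B ab J0 sc nob [tame pB] nV.
have aJ : a \in J l0 by rewrite J0 !inE eqxx.
have bJ : b \in J l0 by rewrite J0 !inE eqxx orbT.
have [_ xp0 x00 xA0 _] := pB l0 l0B.
have [xa xb] : 0 < x l0 a 0 /\ 0 < x l0 b 0 by split; apply: xp0.
pose f l := x l0 a 0 * x l b 0 - x l0 b 0 * x l a 0.
have [alpha al] : exists alpha, forall l, l \in B -> l != l0 -> a \in J l ->
    f l + alpha * ((l - l0) * x l a 0) = 0.
  have us : uniq [seq l <- B | l != l0] by exact: filter_uniq.
  have : (size [seq l <- B | l != l0] <= 1)%N.
    rewrite size_filter -ltnS (leq_trans _ sB) // -(count_predC (fun l => l != l0) B).
    by rewrite -[X in (X < _)%N]addn0 ltn_add2l -has_count; apply/hasP; exists l0; rewrite //= eqxx.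
  case E : [seq l <- B | l != l0] => [|l1 [|]] // _.
    exists 0 => l lB ll0; suff : l \in [::] by [].
    by rewrite -E mem_filter ll0.
  exists (- f l1 / ((l1 - l0) * x l1 a 0)) => l lB ll0 aJl.
  have : l \in [:: l1] by rewrite -E mem_filter ll0.
  rewrite inE => /eqP ll1; rewrite -ll1 divfK ?subrr //.
  by rewrite mulf_neq0 ?subr_eq0 // gt_eqF //; have [_ ->] := pB l lB.
pose w := x l0 a 0 *: delta_mx 0 b - x l0 b 0 *: delta_mx 0 a +
  affine_row C a alpha (- (alpha * l0)).
have wE l : (w *m x l) 0 0 = f l + alpha * ((C *m x l) a 0 - l0 * x l a 0).
  rewrite mulmxDl mxE affine_row_mul mulmxBl -!scalemxAl -!rowE !mxE /f; ring.
have wj j : w 0 j = x l0 a 0 *+ (j == b) - x l0 b 0 *+ (j == a) +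
    (alpha * C a j - (alpha * l0) *+ (j == a)).
  by rewrite mxE affine_rowE !mxE /= !mulr_natr mulNrn.
have [d d0 dV] := row_perturb_near a w (filterI nV (tame_near tame)).
have [t [t0 td ta1]] := small_step alpha d0.
have [VC' tC'] := dV t td; exists (row_perturb C a w t).
have Cab : C a b = 0.
  by have /forall_inP/(_ a aJ)/forall_inP/(_ b bJ)/eqP := sc; rewrite (negPf ab).
split => //; last first.
  apply/negP => /forall_inP/(_ a aJ)/forall_inP/(_ b bJ).
  rewrite mxE eqxx mulr1n Cab add0r (negPf ab) mulr0n wj eqxx [b == a]eq_sym (negPf ab) Cab.
  by rewrite mulr0 !mulr0n !subr0 addr0 mulf_eq0 !gt_eqF.
split.
  move=> l /[dup] lL /tC'[rl|[[k [Jk Ck _]] Dk]|lB]; [by apply: Or31| |by apply: Or33].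
  apply: Or32; exists k; split => //; last exact: Dk.
  move=> j jk; rewrite mxE; case: (eqVneq j a) => [ja|ja]; last by rewrite addr0 Ck.
  have kb : k == b = false by apply/negP => /eqP kb; apply: (nob l lL); rewrite Jk kb.
  rewrite mulr1n wj kb -ja [k == j]eq_sym (negPf jk) !mulr0n !subrr add0r subr0.
  have -> : C j k + t * (alpha * C j k) = (1 + t * alpha) * C j k by ring.
  by rewrite mulr_ge0 // Ck.
move=> l lB; have [Jn xp x0 xA xB] := pB l lB; split => //.
- move=> k kJ; rewrite row_perturb_mul; case: (eqVneq k a) => [ka|ka]; last by rewrite addr0 xA.
  rewrite mulr1n wE -ka xA // -mulrBl; suff -> : f l + alpha * ((l - l0) * x l k 0) = 0.
    by rewrite mulr0 addr0.
  case: (eqVneq l l0) => [->|ll0]; first by rewrite /f mulrC !subrr mul0r mulr0 addr0.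
  by rewrite ka al // -ka.
- move=> k kJ; rewrite row_perturb_mul; case: (eqVneq k a) => [ka|ka]; last by rewrite addr0 xB.
  rewrite mulr1n wE -ka (x0 k kJ) mulr0 subr0 /f -ka (x0 k kJ) mulr0 subr0.
  have -> : (C *m x l) k 0 + t * (x l0 k 0 * x l b 0 + alpha * (C *m x l) k 0) =
    (1 + t * alpha) * (C *m x l) k 0 + t * (x l0 k 0 * x l b 0) by ring.
  rewrite addr_ge0 // mulr_ge0 ?xB // ?(ltW t0) // mulr_ge0 ?ka ?(ltW xa) //.
  by case: (boolP (b \in J l)) => [/xp/ltW|/x0 ->].
Qed.

End ScalarStep.

(** * Splitting the multiple eigenvalues *)

Section SplittingStep.
Variables (R : realType) (e : R) (L : seq R) (J : R -> {set 'I_4}).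
Hypothesis e0 : 0 < e.
Implicit Types (C D : 'M[R]_4) (B : seq R) (V : set 'M[R]_4) (l : R) (m : 'I_4) (K : {set 'I_4}).

(** Only the simplicity of the root is missing for stability. From here on the eigenvalue is kept,
    but no longer a prescribed eigenvector. *)
Definition semi C l : Prop :=
  [/\ J l != finset.set0, root (subpoly C (J l)) l & exists r s, good C l (J l) r s].

Definition state2 B C : Prop :=
  (forall l, l \in L -> [\/ robust e C l, single_ok e J C l | l \in B]) /\
  (forall l, l \in B -> semi C l).

Lemma good_near_mx C l K r s : good C l K r s -> \forall D \near C, good D l K r s.
Proof.
move=> /good_near[[V W] [/= nV nW] VW].
by apply: filterS nV => D VD; apply: (VW (D, l)); split => //=; exact: nbhs_singleton.
Qed.

Lemma subpad_row_perturb C K l m (w : 'rV[R]_4) t : m \in K ->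
  \det (subpad (row_perturb C m w t) K l) =
  \det (subpad C K l) + t * \sum_(j in K) w 0 j * cofactor (subpad C K l) m j.
Proof.
move=> mK; pose w' : 'rV[R]_4 := \row_j (if j \in K then w 0 j else 0).
transitivity (\det (\matrix_(i, j) (subpad C K l i j + (t * w' 0 j) *+ (i == m)))).
  congr (\det _); apply/matrixP => i j; rewrite !mxE.
  case: (boolP (i \in K)) => iK; last first.
    by case: (eqVneq i m) => [im|_]; [move: iK; rewrite im mK|rewrite addr0].
  by case: (j \in K); rewrite ?mulr0 ?mul0rn ?addr0 // addrAC.
rewrite det_row_perturb; congr (_ + _ * _); rewrite [RHS]big_mkcond /=.
by apply: eq_bigr => j _; rewrite !mxE; case: (j \in K); rewrite ?mul0r.
Qed.

Lemma subpad_row_perturb_notin C K l m (w : 'rV[R]_4) t : m \notin K ->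
  subpad (row_perturb C m w t) K l = subpad C K l.
Proof.
move=> mK; apply/matrixP => i j; rewrite !mxE; case: (boolP (i \in K)) => // iK.
by have /negPf -> : i != m; [apply: contraNneq mK => <-|rewrite addr0].
Qed.

(* [u] and [h] are the right and left eigenvectors: the adjugate of [C_J - l] is
   [u h]. *)
Lemma semi_data C l : semi C l -> ~ robust e C l ->
  ('X - l%:P) ^+ 2 %| subpoly C (J l) /\
  exists u h, [/\ prep C l (J l) u, forall m j, cofactor (subpad C (J l) l) m j = h m * u j 0,
    exists r, h r != 0, forall m, m \notin J l -> h m = 0 &
    forall j, j \in J l -> \sum_m h m * C m j = l * h j].
Proof.
move=> [J0 rl [r [s g]]] nr; split.
  by apply/negPn/negP => nd; apply: nr; exact: good_robust J0 g e0 rl nd.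
have P := good_prep J0 g rl; set u := _ *: _ in P.
have [c cJ] := set0Pn _ J0.
have cof : cofactor (subpad C (J l) l) r c != 0.
  by apply: contraTneq (g.1 c cJ) => ->; rewrite mulr0 ltxx.
have uc : u c 0 != 0 by rewrite gt_eqF //; have [_ ->] := P.
have [h hE] := choice (cofactor_proportional (prep_ker P) cof uc).
exists u, h; have hl : (\row_m h m) *m subpad C (J l) l = 0.
  (* Row [c] of the adjugate is [u c 0] times [h], and the adjugate times the singular padded matrix
     is 0. *)
  apply/rowP => j; have := congr1 (fun M : 'M[R]_4 => M c j) (mul_adj_mx (subpad C (J l) l)).
  move: rl; rewrite /root horner_subpoly => /eqP ->; rewrite raddf0 !mxE.
  under eq_bigr do rewrite [X in X * _]mxE hE [h _ * _]mulrC -mulrA.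
  rewrite -mulr_sumr => /eqP; rewrite mulf_eq0 (negPf uc) /= => /eqP hs; rewrite -[RHS]hs.
  by apply: eq_bigr => m _; rewrite [X in X * _]mxE.
have /subpad_lker[h0 hA] := hl.
split => //.
- by exists r; apply: contraNneq cof => hr; rewrite hE hr mul0r.
- by move=> m mJ; have := h0 m mJ; rewrite mxE.
- move=> j jJ; have := hA j jJ; rewrite !mxE => <-.
  by apply: eq_bigr => m _; rewrite mxE.
Qed.

(** At [l] the determinant moves in proportion to [h l m]. The row perturbation keeps it equal to 0
    at every other [l] in [B], and at [l1] moves it against the sign taken by the polynomial near
    [l1], which creates a sign change. *)
Lemma splitting_step B C V : uniq B -> (0 < size B <= 3)%N -> state2 B C -> nbhs C V ->
  exists B' C', [/\ uniq B', (size B' < size B)%N, V C' & state2 B' C'].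
Proof.
move=> uB /andP[B0 B3] [tame sB] nV.
have drop l1 : l1 \in B ->
  [/\ uniq [seq l <- B | l != l1] & (size [seq l <- B | l != l1] < size B)%N].
  move=> l1B; split; first exact: filter_uniq.
  rewrite size_filter -(count_predC (fun l => l != l1) B).
  by rewrite -[X in (X < _)%N]addn0 ltn_add2l -has_count; apply/hasP; exists l1; rewrite //= eqxx.
case: (pselect (exists2 l1, l1 \in B & robust e C l1)) => [[l1 l1B r1]|nrob].
  have [u1 s1] := drop l1 l1B; exists [seq l <- B | l != l1], C; split => //.
    exact: nbhs_singleton.
  split=> l; last by rewrite mem_filter => /andP[_]; exact: sB.
  move=> lL; case: (eqVneq l l1) => [->|ll1]; first exact: Or31.
  by case: (tame l lL) => H; [apply: Or31|apply: Or32|apply: Or33; rewrite mem_filter ll1].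
have nr l : l \in B -> ~ robust e C l by move=> lB rl; apply: nrob; exists l.
have data l : exists uh : 'cV[R]_4 * ('I_4 -> R), l \in B ->
  [/\ prep C l (J l) uh.1,
    forall m j, cofactor (subpad C (J l) l) m j = uh.2 m * uh.1 j 0,
    exists r, uh.2 r != 0, forall m, m \notin J l -> uh.2 m = 0 &
    forall j, j \in J l -> \sum_m uh.2 m * C m j = l * uh.2 j].
  case: (boolP (l \in B)) => lB; last by exists (0, fun=> 0).
  have [_ [u [h H]]] := semi_data (sB l lB) (nr l lB).
  by exists (u, h).
have [uh uhP] := boolp.choice data.
pose u l := (uh l).1; pose h l := (uh l).2.
have hP l : l \in B -> [/\ prep C l (J l) (u l),
    forall m j, cofactor (subpad C (J l) l) m j = h l m * u l j 0,
    exists r, h l r != 0, forall m, m \notin J l -> h l m = 0 &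
    forall j, j \in J l -> \sum_m h l m * C m j = l * h l j] by exact: uhP.
have dbl l : l \in B -> ('X - l%:P) ^+ 2 %| subpoly C (J l).
  by move=> lB; have [] := semi_data (sB l lB) (nr l lB).
have [l1 [m [l1B h1 few]]] : exists l1 m, [/\ l1 \in B, h l1 m != 0 &
    (size [seq l <- B | h l m != 0%R] <= 2)%N].
  (* If no choice works, [B] has three elements and their left eigenvectors share one support [S].
     The three values are eigenvalues of $C_S$, so [S] has at least three elements. *)
  apply: contrapT => none.
  have all_nz l l' m : l \in B -> l' \in B -> h l m != 0 -> size B = 3%N /\ h l' m != 0.
    move=> lB l'B hm; have : (2 < count (fun l => h l m != 0%R) B)%N.
      by rewrite ltnNge -size_filter; apply/negP => few; apply: none; exists l, m.
    have := count_size (fun l => h l m != 0) B => c1 c2.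
    have sB3 : size B = 3%N by apply/eqP; rewrite eqn_leq B3 (leq_trans c2 c1).
    split => //; have : all (fun l => h l m != 0) B by rewrite all_count eqn_leq c1 sB3 c2.
    by move=> /allP; apply.
  have [l0 l0B] : exists l0, l0 \in B by case: (B) B0 => // a s _; exists a; exact: mem_head.
  have [_ _ [r hr] _ _] := hP l0 l0B.
  have [sB3 _] := all_nz _ _ _ l0B l0B hr.
  pose S := [set m | h l0 m != 0]%SET.
  have SJ l : l \in B -> S \subset J l.
    move=> lB; apply/fintype.subsetP => m; rewrite inE => /(all_nz _ _ _ l0B lB)[_].
    by apply: contraNT => mJ; have [_ _ _ h0 _] := hP l lB; apply/eqP/h0.
  have rS : all (root (subpoly C S)) B.
    apply/allP => l lB; rewrite /root horner_subpoly; apply/det0P.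
    have [_ _ [r' hr'] _ hA] := hP l lB.
    exists (\row_m h l m); first by apply: contraNneq hr' => /rowP/(_ r'); rewrite !mxE => /eqP.
    apply/subpad_lker; split=> j; rewrite inE mxE.
      by apply: contraNeq => /(all_nz _ _ _ lB l0B)[].
    move=> jS; rewrite mxE -hA; last by apply: (fintype.subsetP (SJ l lB)); rewrite inE.
    by apply: eq_bigr => i _; rewrite mxE.
  have S3 : (3 <= #|S|)%N.
    have := max_poly_roots (subpoly_neq0 C S) rS uB.
    by rewrite sB3 => /leq_trans /(_ (size_subpoly C S)).
  (* A support with three elements would equal [S], whose cubic polynomial would have three roots,
     one of them double. With full supports, three double roots exceed the degree 4. *)
  have JT l : l \in B -> J l = [set: 'I_4]%SET.
    move=> lB; apply/eqP; rewrite finset.eqEcard finset.subsetT cardsT card_ord leqNgt ltnS.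
    apply/negP => J3; have SE : S = J l.
      by apply/eqP; rewrite finset.eqEcard SJ // (leq_trans J3 S3).
    have sub : {subset [:: l] <= B} by move=> z; rewrite inE => /eqP ->.
    have dd z : z \in [:: l] -> ('X - z%:P) ^+ 2 %| subpoly C S.
      by rewrite inE => /eqP ->; rewrite SE dbl.
    have := double_roots_count (subpoly_neq0 C S) uB (isT : uniq [:: l]) sub rS dd.
    rewrite sB3 => /leq_trans /(_ (size_subpoly C S)).
    by rewrite ltnS SE leqNgt ltnS J3.
  have rT : all (root (subpoly C [set: 'I_4]%SET)) B.
    by apply/allP => l lB; rewrite -(JT l lB); have [/prep_root] := hP l lB.
  have dT z : z \in B -> ('X - z%:P) ^+ 2 %| subpoly C [set: 'I_4]%SET.
    by move=> zB; rewrite -(JT z zB) dbl.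
  have := double_roots_count (subpoly_neq0 C _) uB uB (fun z zB => zB) rT dT.
  by rewrite sB3 => /leq_trans /(_ (size_subpoly C _)); rewrite cardsT card_ord.
have [P1 _ _ h01 _] := hP l1 l1B.
have [J10 r1 [rr [ss g1]]] := sB l1 l1B.
have mJ1 : m \in J l1 by apply: contraNT h1 => /h01 ->.
have um : 0 < u l1 m 0 by have [_ ->] := P1.
have [sg sg0 sgP] := nonzero_poly_sign_near l1 (subpoly_neq0 C (J l1)).
have [alpha [beta ab]] := @affine_interpolation R [seq l <- B | h l m != 0%R]
  (fun l => if l == l1 then - (sg * h l1 m) else 0) (filter_uniq _ uB) few.
have qE t l : l \in B -> \det (subpad (row_perturb C m (affine_row C m alpha beta) t) (J l) l) =
    t * (h l m * ((alpha * l + beta) * u l m 0)).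
  move=> lB; have [[_ up u0 uA _] cE _ h0 _] := hP l lB.
  have [_ rl _] := sB l lB; move: rl; rewrite /root horner_subpoly => /eqP q0.
  case: (boolP (m \in J l)) => mJ; last first.
    by rewrite subpad_row_perturb_notin // q0 h0 // mul0r mulr0.
  rewrite subpad_row_perturb // q0 add0r; congr (_ * _).
  have <- : (affine_row C m alpha beta *m u l) 0 0 = (alpha * l + beta) * u l m 0.
    by rewrite affine_row_mul uA // mulrA -mulrDl.
  rewrite mxE mulr_sumr big_mkcond /=; apply: eq_bigr => j _; case: (boolP (j \in J l)) => jJ.
    by rewrite cE mulrCA.
  by rewrite /u u0 // mulr0 mulr0.
have [d1 d10 rob1] := good_sign_change_robust J10 g1 e0.
have [a al1 sa] := sgP d1 d10.
have na : \forall D \near C, 0 < sg * (subpoly D (J l1)).[a].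
  have c : continuous (fun D : 'M[R]_4 => - (- sg * (subpoly D (J l1)).[a])).
    apply: (@continuous_mulN R 'M[R]_4 (fun=> - sg)); last exact: continuous_subpoly.
    by move=> D; exact: cst_continuous.
  have := @continuous_gt0_near R _ _ C c; rewrite mulNr opprK => /(_ sa).
  by apply: filterS => D; rewrite mulNr opprK.
have ng : \forall D \near C, forall l, l \in B -> exists r s, good D l (J l) r s.
  apply: near_all_seq => l lB; have [_ _ [r [s g]]] := sB l lB.
  by apply: filterS (good_near_mx g) => D gD; exists r, s.
have [d d0 dV] := row_perturb_near m (affine_row C m alpha beta)
  (filterI nV (filterI (tame_near tame) (filterI rob1 (filterI na ng)))).
have [t [t0 td ta1]] := small_step alpha d0.
have [VC' [tC' [robC' [aC' gC']]]] := dV t td.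
set C' := row_perturb _ _ _ _ in VC' tC' robC' aC' gC'.
have [uB' sB'] := drop l1 l1B.
exists [seq l <- B | l != l1], C'; split => //; split=> l; last first.
  rewrite mem_filter => /andP[ll1 lB]; have [Jl0 _ _] := sB l lB.
  split => //; last exact: gC'.
  rewrite /root horner_subpoly qE //; case: (eqVneq (h l m) 0) => [->|hlm].
    by rewrite mul0r mulr0.
  by rewrite ab ?mem_filter ?hlm // (negPf ll1) mul0r !mulr0.
move=> lL; case: (eqVneq l l1) => [->|ll1].
  apply: Or31; apply: (robC' a l1) => //; first by rewrite subrr normr0.
  have q1 : sg * (subpoly C' (J l1)).[l1] < 0.
    rewrite horner_subpoly qE // ab ?mem_filter ?h1 // eqxx.
    have -> : sg * (t * (h l1 m * (- (sg * h l1 m) * u l1 m 0))) =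
      - (t * (sg * h l1 m) ^+ 2 * u l1 m 0) by ring.
    have p2 : 0 < (sg * h l1 m) ^+ 2 by rewrite exprn_even_gt0 //= mulf_neq0.
    by rewrite oppr_lt0 mulr_gt0 // mulr_gt0.
  have : sg ^+ 2 * ((subpoly C' (J l1)).[a] * (subpoly C' (J l1)).[l1]) < 0.
    by rewrite expr2 mulrACA pmulr_rlt0.
  by rewrite pmulr_rlt0 // exprn_even_gt0.
case: (tC' l lL) => [rl|[[k [Jk Ck _]] Dk]|lB]; [exact: Or31| |].
  apply: Or32; exists k; split => //; last exact: Dk.
  move=> j jk; rewrite mxE; case: (eqVneq j m) => [jm|jm]; last by rewrite addr0 Ck.
  rewrite mulr1n affine_rowE -jm [k == j]eq_sym (negPf jk) mulr0n addr0.
  have -> : C j k + t * (alpha * C j k) = (1 + t * alpha) * C j k by ring.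
  by rewrite mulr_ge0 // Ck.
by apply: Or33; rewrite mem_filter ll1.
Qed.

Lemma all_splitting_steps B C V : uniq B -> (size B <= 3)%N -> state2 B C -> nbhs C V ->
  exists C', V C' /\ state2 [::] C'.
Proof.
move: {2}(size B) (leqnn (size B)) => k; elim: k B C V => [|k IH] B C V sBk uB B3 st nV.
  by move: st; rewrite (size0nil (eqP (etrans (esym (leqn0 _)) sBk))); exists C; split => //;
    exact: nbhs_singleton.
case: (posnP (size B)) => [/size0nil B0|B0].
  by move: st; rewrite B0; exists C; split => //; exact: nbhs_singleton.
have B13 : (0 < size B <= 3)%N by rewrite B0.
have [B' [C1 [uB' sB' VC1 st1]]] := splitting_step uB B13 st (nbhs_interior nV).
apply: (IH B' C1 V) => //; first by rewrite -ltnS (leq_trans sB').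
exact: leq_trans (ltnW sB') B3.
Qed.

(** Adding the same small positive number to all entries makes the zeros of the relevant columns
    positive, and positivity is open. *)
Lemma single_step C V : state2 [::] C -> nbhs C V ->
  exists C', V C' /\ forall l, l \in L -> robust e C' l.
Proof.
move=> [tame _] nV.
have [d d0 dV] := nbhs_direction (const_mx 1) (filterI nV (tame_near tame)).
have [t [t0 td _]] := small_step 0 d0; have [VC' tC'] := dV t td.
exists (C + t *: const_mx 1); split => // l /tC'[//|[[k [Jk Ck _]] Dk]|//].
have kl := Dk k Jk.
have C'0 i : i != k -> 0 < (C + t *: const_mx 1) i k.
  by move=> ik; rewrite !mxE mulr1 ltr_wpDl // Ck.
have n1 : \forall D \near (C + t *: const_mx 1), forall i, i != k -> 0 < (D : 'M[R]_4) i k.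
  apply: near_forall_in => i ik; apply: continuous_gt0_near (C'0 i ik).
  exact: continuous_entry.
apply: filterS2 n1 (diag_near kl) => D D0 Dkl; exists (D k k) => //.
by apply: prep_pareto; apply: prep_single => i ik; apply/ltW/D0.
Qed.

End SplittingStep.

(** * Assembling the perturbation steps *)

Section RobustApproximation.
Variables (R : realType) (A : 'M[R]_4) (L : seq R) (e : R).
Variables (J : R -> {set 'I_4}) (x : R -> 'cV[R]_4).
Hypotheses (uniqL : uniq L) (e0 : 0 < e) (L24 : (24 <= size L)%N).
Hypothesis minL : forall l, l \in L -> minrep A l (J l) (x l).

(** An open condition that keeps the kernel of the padded matrix at most one-dimensional. *)
Let cofactor_ok (C : 'M[R]_4) l :=
  exists r c, c \in J l /\ cofactor (subpad C (J l) l) r c != 0.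

Lemma cofactor_ok_near C l : cofactor_ok C l -> \forall D \near C, cofactor_ok D l.
Proof.
move=> [r [c [cJ cof]]].
have cc : continuous (fun D : 'M[R]_4 => cofactor (subpad D (J l) l) r c).
  apply: continuous_cofactor => i j.
  apply: (@continuous_subpad R 4 (J l) 'M[R]_4 id (fun=> l) i j (@continuous_entry _ _)) => t.
  exact: cst_continuous.
have c2 := continuous_mulN cc cc.
have c3 : continuous (fun D : 'M[R]_4 => - (- (cofactor (subpad D (J l) l) r c *
    cofactor (subpad D (J l) l) r c) * 1)).
  by apply: continuous_mulN => // D; exact: cst_continuous.
have := @continuous_gt0_near R _ _ C c3; rewrite mulr1 opprK -expr2 exprn_even_gt0 //= => /(_ cof).
apply: filterS => D; rewrite mulr1 opprK -expr2 exprn_even_gt0 //= => cofD.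
by exists r, c.
Qed.

Lemma minrep_cofactor_ok l : l \in L -> (1 < #|J l|)%N -> ~~ scalar_pair A J l ->
  cofactor_ok A l.
Proof.
move=> lL J1 nsc; have mr := minL lL; have P := mr.1.
have [c cJ] : exists c, c \in J l by apply/set0Pn; have [] := P.
have xc : x l c 0 != 0 by rewrite gt_eqF //; have [_ ->] := P.
have line : forall z : 'cV[R]_4, subpad A (J l) l *m z = 0 -> z c 0 = 0 -> z = 0.
  case: (leqP 3 #|J l|) => J3; first exact: (minrep_ker_line mr).
  have J2 : #|J l| = 2%N by apply/eqP; rewrite eqn_leq -ltnS J3.
  by apply: (pair_ker_line P J2) => //; move: nsc; rewrite /scalar_pair J2.
have [r cof] := ker_cofactor_neq0 (prep_ker P) xc line.
by exists r, c.
Qed.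

(** The two indices outside the pair give two distinct triples, and both are charged. *)
Lemma scalar_charges l : l \in L -> scalar_pair A J l -> (2 <= \sum_K charge A J x l K)%N.
Proof.
move=> lL sc; have /andP[/eqP J2 _] := sc.
pose X := [set (i |: J l)%SET | i in ~: J l]%SET.
have cX : #|X| = 2%N.
  have cJ : #|~: J l| = 2%N by rewrite cardsCs finset.setCK card_ord J2.
  rewrite -[RHS]cJ; apply: card_in_imset => i j; rewrite !inE => iJ jJ E.
  by have := setU11 i (J l); rewrite E !inE (negPf iJ) orbF => /eqP.
apply: (leq_trans (eq_leq (esym cX))); rewrite -sum1_card big_mkcond /=; apply: leq_sum => K _.
case: ifP => // /imsetP[i]; rewrite inE => iJ ->.
rewrite lt0b /charge J2 /=; apply/orP; left; apply/existsP; exists i.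
by rewrite iJ eqxx sc orbT.
Qed.

Let B := [seq l <- L | [exists K, charge A J x l K]].

Lemma charged_sum l : l \in B -> (1 <= \sum_K charge A J x l K)%N.
Proof.
by rewrite mem_filter => /andP[/existsP[K chK] _]; rewrite (bigD1 K) //= chK.
Qed.

Lemma sum_charged : (\sum_(l <- B) \sum_K charge A J x l K <= 3)%N.
Proof.
apply: leq_trans (charges_le3 uniqL minL L24).
by rewrite big_filter big_mkcond /=; apply: leq_sum => l _; case: ifP.
Qed.

Lemma charged_card l : l \in B -> (1 < #|J l|)%N.
Proof. by rewrite mem_filter => /andP[/existsP[K /andP[]]]. Qed.

(** A scalar block, a zero inequality or a double root would each produce a charge; without them
    [good_robust] applies. *)
Lemma uncharged_robust l : l \in L -> l \notin B -> (1 < #|J l|)%N -> robust e A l.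
Proof.
move=> lL; rewrite mem_filter lL andbT negb_exists => /forallP nch J1.
have P := (minL lL).1; have [J0 xp x0 xA xB] := P.
have nsc : ~~ scalar_pair A J l.
  apply/negP => /[dup] sc /andP[/eqP J2 _].
  have [i iJ] : exists i, i \notin J l.
    apply/existsP; rewrite -negb_forall; apply: contra_eqN J2 => /forallP JT.
    suff -> : J l = [set: 'I_4]%SET by rewrite cardsT card_ord.
    by apply/setP => i; rewrite JT inE.
  have /negP := nch (i |: J l)%SET; apply; rewrite /charge J1 /=.
  by apply/orP; left; apply/existsP; exists i; rewrite iJ eqxx sc orbT.
have ext i : i \notin J l -> 0 < (A *m x l) i 0.
  move=> iJ; rewrite lt_def xB // andbT; apply/negP => /eqP Ai.
  have /negP := nch (i |: J l)%SET; apply; rewrite /charge J1 /=.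
  by apply/orP; left; apply/existsP; exists i; rewrite iJ Ai !eqxx.
have [r [c [cJ cof]]] := minrep_cofactor_ok lL J1 nsc.
have [s g] := prep_good P ext cJ cof.
apply: (good_robust J0 g e0 (prep_root P)); apply/negP => dbl.
have /negP := nch (J l); apply; rewrite /charge J1 /=.
by apply/orP; right; rewrite eqxx dbl.
Qed.

Lemma state1_start : state1 e L J x B A.
Proof.
split=> l; last by rewrite mem_filter => /andP[_ /minL[]].
move=> lL; case: (boolP (l \in B)) => lB; first exact: Or33.
case: (ltnP 1 #|J l|) => J1; first by apply: Or31; exact: uncharged_robust.
apply: Or32; have [J0 xp x0 xA xB] := (minL lL).1.
have /cards1P[k Jk] : #|J l| == 1%N by rewrite eqn_leq J1 card_gt0.
have xE i : (A *m x l) i 0 = A i k * x l k 0.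
  rewrite mxE (bigD1 k) //= big1 ?addr0 // => j jk.
  by rewrite x0 ?mulr0 // Jk inE.
have xk : 0 < x l k 0 by rewrite xp // Jk inE.
exists k; split => //.
  by move=> i ik; have := xB i; rewrite xE pmulr_lge0 // Jk inE; apply.
have := xA k; rewrite xE Jk inE eqxx => /(_ isT) /(mulIf (lt0r_neq0 xk)) ->.
by rewrite subrr normr0.
Qed.

(** A scalar pair takes two of the at most three charges. So [B] has at most one other element,
    which is not scalar, and one [scalar_step] suffices. *)
Lemma nonscalar_start V : nbhs A V ->
  exists C, [/\ V C, state1 e L J x B C & forall l, l \in B -> cofactor_ok C l].
Proof.
move=> nV; have uB : uniq B by exact: filter_uniq.
have BL l : l \in B -> l \in L by rewrite mem_filter => /andP[].
case: (boolP (has (scalar_pair A J) B)) => [/hasP[l0 l0B sc0]|/hasPn nsc]; last first.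
  exists A; split; [exact: nbhs_singleton|exact: state1_start|move=> l lB].
  by apply: minrep_cofactor_ok; [exact: BL|exact: charged_card|exact: nsc].
have l0L := BL l0 l0B.
have sums : (\sum_K charge A J x l0 K + \sum_(l <- rem l0 B) \sum_K charge A J x l K <= 3)%N.
  by have := sum_charged; rewrite (perm_big _ (perm_to_rem l0B)) big_cons.
have s1 : (\sum_(l <- rem l0 B) \sum_K charge A J x l K <= 1)%N.
  by rewrite -(leq_add2l 2) (leq_trans _ sums) // leq_add2r scalar_charges.
have B2 : (size B <= 2)%N.
  rewrite (perm_size (perm_to_rem l0B)) /= ltnS (leq_trans _ s1) // -sum1_size.
  rewrite [leqLHS]big_seq [leqRHS]big_seq; apply: leq_sum => l lr.
  by apply: charged_sum; exact: mem_rem lr.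
have nsc l : l \in B -> l != l0 -> ~~ scalar_pair A J l.
  move=> lB ll0; apply/negP => sc; move: s1; apply/negP; rewrite -ltnNge.
  have lr : l \in rem l0 B by rewrite mem_rem_uniq // inE ll0.
  rewrite (perm_big _ (perm_to_rem lr)) big_cons; apply: leq_trans (leq_addr _ _).
  exact: scalar_charges (BL l lB) sc.
have /andP[/cards2P[a [b [ab J0]]] sb] := sc0.
(* An eigenvalue represented on [[set b]] would be [A b b = l0], whose chosen support has two
   elements. *)
have nob l : l \in L -> J l <> [set b]%SET.
  move=> lL Jl; have P := (minL lL).1; rewrite Jl in P; have [_ xp x0 xA _] := P.
  have xb : x l b 0 != 0 by rewrite gt_eqF // xp // inE.
  have : l = A b b.
    have := xA b; rewrite inE eqxx mxE (bigD1 b) //= big1 ?addr0 => [/(_ isT)/(mulIf xb)//|j jb].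
    by rewrite x0 ?mulr0 // inE.
  have /forall_inP/(_ b) := sb; rewrite J0 !inE eqxx orbT => /(_ isT)/forall_inP/(_ b).
  rewrite !inE !eqxx orbT mulr1n => /(_ isT)/eqP -> ll0.
  by have := cards2 a b; rewrite ab -J0 -ll0 Jl cards1.
have ncof : \forall D \near A, forall l, l \in B -> l != l0 -> cofactor_ok D l.
  apply: near_all_seq => l lB; case: (eqVneq l l0) => [_|ll0]; first by apply: near_all.
  have ok := minrep_cofactor_ok (BL l lB) (charged_card lB) (nsc l lB ll0).
  by apply: filterS (cofactor_ok_near ok).
have [C [[VC cofC] SC nscC]] := scalar_step uB B2 l0B ab J0 sb nob state1_start (filterI nV ncof).
exists C; split => // l lB; case: (eqVneq l l0) => [->|]; last exact: cofC.
have P := SC.2 l0 l0B; have aJ : a \in J l0 by rewrite J0 !inE eqxx.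
have xa : x l0 a 0 != 0 by rewrite gt_eqF //; have [_ ->] := P.
have J2 : #|J l0| = 2%N by rewrite J0 cards2 ab.
have [r cof] := ker_cofactor_neq0 (prep_ker P) xa (pair_ker_line P J2 nscC aJ).
by exists r, a.
Qed.

Theorem robust_approximation V : nbhs A V ->
  exists C, V C /\ forall l, l \in L -> robust e C l.
Proof.
move=> nV; have uB : uniq B by exact: filter_uniq.
have B3 : (size B <= 3)%N.
  rewrite (leq_trans _ sum_charged) // -sum1_size [leqLHS]big_seq [leqRHS]big_seq.
  by apply: leq_sum => l; exact: charged_sum.
have [C1 [VC1 S1 cof1]] := nonscalar_start (nbhs_interior nV).
have ncof : \forall D \near C1, forall l, l \in B -> cofactor_ok D l.
  by apply: near_all_seq => l lB; exact: cofactor_ok_near (cof1 l lB).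
have [C2 [[VC2 cof2] S2 ext]] := all_rows_step uB B3 S1 (filterI (nbhs_interior VC1) ncof).
have S2' : state2 e L J B C2.
  split; first exact: S2.1.
  move=> l lB; have P := S2.2 l lB; have [J0 _ _ _ _] := P.
  have [r [c [cJ cof]]] := cof2 l lB.
  have [s g] := prep_good P (fun i => ext l i lB) cJ cof.
  by split => //; [exact: prep_root P|exists r, s].
have [C3 [VC3 S3]] := all_splitting_steps e0 uB B3 S2' (nbhs_interior VC2).
exact: single_step S3 VC3.
Qed.

End RobustApproximation.

(** * Genericity *)

Section LinePolynomials.
Variables (R : realType) (n : nat) (I : eqType) (F : I -> 'M[R]_n -> R).
Hypothesis linepoly : forall i (C D : 'M[R]_n),
  exists p : {poly R}, forall t, F i (C + t *: D) = p.[t].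

(** On the line from [C] to a witness [M], each condition is a nonzero polynomial: the earlier ones
    do not vanish at 0, nor the new one at 1. Their product is nonzero at some arbitrarily small
    parameter. *)
Lemma generic_near (s : seq I) (A : 'M[R]_n) V :
  (forall i, i \in s -> exists M, F i M != 0) -> nbhs A V ->
  exists C, V C /\ forall i, i \in s -> F i C != 0.
Proof.
elim: s V => [|i s IH] V wit nV; first by exists A; split => //; exact: nbhs_singleton.
have [j js|C [VC FC]] := IH _ _ (nbhs_interior nV); first by apply: wit; rewrite inE js orbT.
have [M FM] := wit i (mem_head _ _).
have [q qP] := boolp.choice (fun j => linepoly j C (M - C)).
pose P := \prod_(j <- i :: s) q j.
have P0 : P != 0.
  rewrite prodf_seq_neq0; apply/allP => j; rewrite inE => /orP[/eqP->|js] /=.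
    apply: contraNneq FM => q0; have := qP i 1; rewrite q0 horner0 scale1r.
    by rewrite addrCA subrr addr0 => ->.
  apply: contraNneq (FC j js) => q0; have := qP j 0; rewrite q0 horner0 scale0r.
  by rewrite addr0 => ->.
have [d d0 dV] := nbhs_direction (M - C) VC.
have [r _ /(_ d d0)[t]] := nonzero_poly_sign_near 0 P0.
rewrite subr0 => td rP; exists (C + t *: (M - C)); split; first exact: dV.
move=> j js; rewrite qP; apply: contraTneq rP => qj.
by rewrite /P horner_prod (big_rem j) //= qj mul0r mulr0 ltxx.
Qed.

End LinePolynomials.

Section Generic.
Variables (R : realType) (n : nat).
Implicit Types (J K : {set 'I_n}) (C D M : 'M[R]_n).

Definition psub (T : Type) (M : 'M[T]_n) (J : {set 'I_n}) : 'M[T]_#|J| :=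
  mxsub (fun i : 'I_#|J| => enum_val i) (fun i : 'I_#|J| => enum_val i) M.

(* Defined over any ring, so as to be applied to the line [C + 'X D]. *)
Definition simplicity (T : comNzRingType) (M : 'M[T]_n) (JK : {set 'I_n} * {set 'I_n}) : T :=
  if JK.1 == JK.2 then resultant (char_poly (psub M JK.1)) (char_poly (psub M JK.1))^`()
  else resultant (char_poly (psub M JK.1)) (char_poly (psub M JK.2)).

Lemma lead_coef_deriv_monic (T : idomainType) (p : {poly T}) m :
  p \is monic -> size p = m.+2 -> m.+1%:R != 0 :> T -> lead_coef p^`() = m.+1%:R.
Proof.
move=> mp sp m0; have c : p^`()`_m = m.+1%:R.
  by rewrite coef_deriv; have := monicP mp; rewrite lead_coefE sp /= => ->.
have sz : size p^`() = m.+1.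
  apply/eqP; rewrite eqn_leq; apply/andP; split.
    by have := lt_size_deriv (monic_neq0 mp); rewrite sp ltnS.
  by apply: contraNT m0; rewrite -leqNgt -c => /(nth_default 0) ->.
by rewrite lead_coefE sz.
Qed.

(** Evaluation at [t] commutes with the resultant because the leading coefficients, 1 and [#|J|], do
    not vanish. *)
Lemma simplicity_linepoly J K C D : J != finset.set0 ->
  exists p : {poly R}, forall t, simplicity (C + t *: D) (J, K) = p.[t].
Proof.
move=> J0; pose N : 'M[{poly R}]_n := map_mx polyC C + 'X *: map_mx polyC D.
exists (simplicity N (J, K)) => t.
have NE S : map_mx (horner_eval t) (psub N S) = psub (C + t *: D) S.
  by apply/matrixP => i j; rewrite !mxE /= /horner_eval !hornerE.
have mc (S : {set 'I_n}) : horner_eval t (lead_coef (char_poly (psub N S))) != 0.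
  by rewrite (monicP (char_poly_monic _)) rmorph1 oner_eq0.
have J1 : #|J| = #|J|.-1.+1 by rewrite prednK // card_gt0.
rewrite -[in RHS]/(horner_eval t _) /simplicity /=; case: ifP => _.
  rewrite map_resultant ?mc // -?deriv_map; first by rewrite !map_char_poly NE.
  rewrite (@lead_coef_deriv_monic _ _ #|J|.-1) ?char_poly_monic ?size_char_poly -?J1 //.
    by rewrite rmorph_nat pnatr_eq0 -lt0n card_gt0.
  by rewrite -polyC_natr polyC_eq0 pnatr_eq0 -lt0n card_gt0.
by rewrite map_resultant ?mc // !map_char_poly !NE.
Qed.

Lemma resultant_coprimep (F : fieldType) (p q : {poly F}) : p != 0 ->
  (resultant p q != 0) = coprimep p q.
Proof.
move=> p0; have s1 : (0 < size (gcdp p q))%N.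
  by rewrite lt0n size_poly_eq0 gcdp_eq0 negb_and p0.
by rewrite resultant_eq0 -leqNgt coprimep_def eqn_leq s1 andbT.
Qed.

Lemma principally_simpleP C :
  (forall J K, J != finset.set0 -> simplicity C (J, K) != 0) -> principally_simple C.
Proof.
move=> H; have nz S : char_poly (psub C S) != 0 by rewrite monic_neq0 ?char_poly_monic.
split=> [J a J0|J K J0 K0 JK [a []]]; rewrite !eigenvalue_root_char.
  move=> ra; have := H J J J0; rewrite /simplicity eqxx resultant_coprimep // => cop.
  have pz := nz J; apply/eqP; rewrite eqn_leq -ltnS mup_ltn // -XsubC_dvd // dvdp_XsubCl ra andbT.
  apply/negP => /dvdpP[q qE]; have := coprimep_root cop ra; rewrite [X in X^`()]qE.
  by rewrite expr2 mulrA derivM hornerD !hornerM hornerXsubC subrr !(mulr0, mul0r, addr0) eqxx.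
move=> rJ rK; have := H J K J0; rewrite /simplicity /= (negPf JK) resultant_coprimep // => cop.
by have := coprimep_root cop rJ; rewrite (rootP rK) eqxx.
Qed.

Lemma simple_witness J : exists M, simplicity M (J, J) != 0.
Proof.
pose M : 'M[R]_n := diag_mx (\row_i (i : nat)%:R); exists M.
have tr : is_trig_mx (psub M J).
  apply/is_trig_mxP => i j ij; rewrite !mxE; case: eqP => // /enum_val_inj E.
  by move: ij; rewrite E ltnn.
rewrite /simplicity eqxx resultant_coprimep ?monic_neq0 ?char_poly_monic //=.
rewrite (char_poly_trig tr) -(big_map (fun i => psub M J i i) xpredT (fun z => 'X - z%:P)).
have := separable_prod_XsubC [seq psub M J i i | i <- index_enum (ordinal #|J|)].
rewrite separable_poly.unlock => ->.
rewrite map_inj_uniq ?index_enum_uniq // => i j; rewrite !mxE !eqxx !mulr1n => /eqP.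
by rewrite eqr_nat => /eqP/val_inj/enum_val_inj.
Qed.

(** With [k] in [K] but not in [J], the witness has ones off the diagonal in row and column [k]
    only. Its block on [J] is diagonal, and none of its entries is an eigenvalue of the arrow-shaped
    block on [K]. *)
Lemma coprime_witness J K : ~~ (K \subset J) ->
  exists M, coprimep (char_poly (psub M J)) (char_poly (psub M K)).
Proof.
move=> /subsetPn[k kK kJ].
pose M mu : 'M[R]_n := \matrix_(i, j)
  if i == j then (if i \in K then (if i == k then 0 else (i : nat)%:R) else mu)
  else ((i == k) || (j == k))%:R.
have MK mu : psub (M mu) K = psub (M 0) K.
  by apply/matrixP => i j; rewrite !mxE !enum_valP.
pose q := char_poly (psub (M 0) K).
have q0 : q != 0 by rewrite monic_neq0 ?char_poly_monic.
(* The block on [K] does not involve [mu], so [mu] can be taken outside the roots of [q]. *)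
have [s _ /(_ 1 ltr01)[mu _ smu]] := nonzero_poly_sign_near 0 q0.
have qmu : ~~ root q mu by apply: contraTN smu => /rootP ->; rewrite mulr0 ltxx.
exists (M mu); rewrite MK.
have tr : is_trig_mx (psub (M mu) J).
  apply/is_trig_mxP => i j ij; rewrite !mxE; case: eqP => [/enum_val_inj E|_].
    by move: ij; rewrite E ltnn.
  have nk (a : 'I_#|J|) : enum_val a == k = false.
    by apply: contraNF kJ => /eqP <-; exact: enum_valP.
  by rewrite !nk.
rewrite (char_poly_trig tr); apply: (big_ind (fun p => coprimep p q)).
- exact: coprime1p.
- by move=> p1 p2 c1 c2; rewrite coprimepMl c1.
move=> a _; rewrite coprimep_sym coprimep_XsubC !mxE eqxx; case: ifP => // aK.
have -> : (enum_val a == k) = false by apply: contraNF kJ => /eqP <-; exact: enum_valP.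
set j := enum_val a in aK *; have jk : j != k.
  by apply: contraNneq kJ => <-; exact: enum_valP.
apply/negP; rewrite -eigenvalue_root_char => /eigenvalueP[v vM v0].
pose ik := enum_rank_in kK k; pose ij := enum_rank_in kK j.
have eik : enum_val ik = k by rewrite enum_rankK_in.
have eij : enum_val ij = j by rewrite enum_rankK_in.
(* Column [j] gives $v_k = 0$; the other columns then give $v_b = 0$, as their diagonal entries
   differ from [j]; column [k] finally gives $v_j = 0$. *)
have col b : b != ik -> v 0 b * (enum_val b : nat)%:R + v 0 ik = (j : nat)%:R * v 0 b.
  move=> bk; have := congr1 (fun w : 'rV[R]_#|K| => w 0 b) vM; rewrite !mxE => <-.
  have ebk : enum_val b == k = false.
    by apply: contraNF bk => /eqP E; apply/eqP/enum_val_inj; rewrite E eik.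
  rewrite (bigD1 b) //= (bigD1 ik) 1?eq_sym //= big1 ?addr0.
    rewrite !mxE eqxx enum_valP ebk eik [k == _]eq_sym ebk eqxx /= mulr1 //.
  move=> c /andP[cb ck]; rewrite !mxE (inj_eq enum_val_inj) (negPf cb) ebk.
  have -> : enum_val c == k = false.
    by apply: contraNF ck => /eqP E; apply/eqP/enum_val_inj; rewrite E eik.
  by rewrite mulr0.
have ijk : ij != ik by apply: contraNneq jk => E; rewrite -eij E eik.
have vk : v 0 ik = 0.
  by have := col ij ijk; rewrite eij mulrC => /eqP; rewrite -subr_eq0 addrC addKr => /eqP.
have vb b : b != ik -> b != ij -> v 0 b = 0.
  move=> bk bj; have := col b bk; rewrite vk addr0 mulrC => /eqP; rewrite -subr_eq0 -mulrBl.
  rewrite mulf_eq0 subr_eq0 eqr_nat => /orP[/eqP/val_inj E|/eqP//].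
  by move: bj; rewrite -(inj_eq enum_val_inj) E eij eqxx.
have vj : v 0 ij = 0.
  have := congr1 (fun w : 'rV[R]_#|K| => w 0 ik) vM; rewrite !mxE vk mulr0 => H.
  rewrite -[RHS]H (bigD1 ij) //= big1 ?addr0.
    by rewrite !mxE eik eij (negPf jk) eqxx orbT mulr1.
  move=> c cj; case: (eqVneq c ik) => [->|ck]; first by rewrite vk mul0r.
  by rewrite vb // mul0r.
case/eqP: v0; apply/rowP => b; rewrite mxE.
case: (eqVneq b ik) => [->//|bk]; case: (eqVneq b ij) => [->//|bj]; exact: vb.
Qed.

Lemma principally_simple_dense (A : 'M[R]_n) V : nbhs A V ->
  exists C, V C /\ principally_simple C.
Proof.
move=> nV.
pose s := [seq JK <- enum {: {set 'I_n} * {set 'I_n}} | JK.1 != finset.set0].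
(* The value 0 for an empty first set makes [F] polynomial on lines for every index; such indices
   are left out of [s]. *)
pose F (i : {set 'I_n} * {set 'I_n}) (C : 'M[R]_n) : R :=
  if i.1 != finset.set0 then simplicity C i else 0.
have lin i C D : exists p : {poly R}, forall t, F i (C + t *: D) = p.[t].
  case: i => J K; rewrite /F /=; case: (boolP (J != finset.set0)) => J0.
    exact: simplicity_linepoly.
  by exists 0 => t; rewrite horner0.
have wit i : i \in s -> exists M, F i M != 0.
  case: i => J K; rewrite mem_filter /F /= => /andP[-> _].
  case: (eqVneq J K) => [<-|JK]; first exact: simple_witness.
  rewrite /simplicity /= (negPf JK); have [KJ|] := boolP (K \subset J).
    have JK' : ~~ (J \subset K) by apply: contra JK => JK; rewrite finset.eqEsubset JK.
    have [M cM] := coprime_witness JK'; exists M.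
    by rewrite resultant_coprimep ?monic_neq0 ?char_poly_monic // coprimep_sym.
  move=> /coprime_witness[M cM]; exists M.
  by rewrite resultant_coprimep ?monic_neq0 ?char_poly_monic.
have [C [VC FC]] := generic_near lin wit nV.
exists C; split => //; apply: principally_simpleP => J K J0.
by have := FC (J, K); rewrite mem_filter /= J0 mem_enum /F /= J0; apply.
Qed.

End Generic.

(** * Finiteness of the spectrum, separation and conclusion *)

Lemma finite_pareto_spectrum (R : realType) n (A : 'M[R]_n) :
  finite_set (pareto_spectrum A).
Proof.
apply: contrapT => /infinite_set_fset inf.
(* Every Pareto eigenvalue is a root of some [subpoly A J], hence of this nonzero product. *)
pose P := \prod_(J : {set 'I_n}) subpoly A J.
have P0 : P != 0 by apply/prodf_neq0 => J _; exact: subpoly_neq0.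
have [X XA sX] := inf (size P).
have rX : all (root P) (finmap.enum_fset X).
  apply/allP => l lX; have /pareto_prep[J [x /prep_root rl]] := XA l lX.
  by rewrite /P (bigD1 J) //= rootM rl.
have := max_poly_roots P0 rX (finmap.fset_uniq X).
by rewrite ltnNge sX.
Qed.

(** Approximations within [e] of distinct elements remain distinct. *)
Lemma separated_seq (R : realType) (s : seq R) : exists2 e : R, 0 < e &
  forall l m, l \in s -> m \in s -> l != m -> e + e <= `|l - m|.
Proof.
elim: s => [|a s [e e0 IH]]; first by exists 1.
have [d d0 dP] : exists2 d, 0 < d & forall l, l \in s -> l != a -> d + d <= `|l - a|.
  elim: s {IH} => [|b s [d d0 IH]]; first by exists 1.
  case: (eqVneq b a) => [->|ba].
    by exists d => // l; rewrite inE => /orP[/eqP->|/IH//]; rewrite eqxx.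
  have b0 : 0 < `|b - a| / 2 by rewrite divr_gt0 // normr_gt0 subr_eq0.
  exists (Num.min d (`|b - a| / 2)); first by rewrite lt_min d0.
  move=> l; rewrite inE => /orP[/eqP-> _|ls la].
    by rewrite [leRHS]splitr lerD // ge_min lexx orbT.
  by apply: le_trans (IH l ls la); rewrite lerD // ge_min lexx.
exists (Num.min e d); first by rewrite lt_min e0.
have em : Num.min e d <= e by rewrite ge_min lexx.
have dm : Num.min e d <= d by rewrite ge_min lexx orbT.
move=> l m; rewrite !inE => /orP[/eqP->|ls] /orP[/eqP->|ms] lm.
- by rewrite eqxx in lm.
- by rewrite distrC; apply: le_trans (dP m ms _); [rewrite lerD|rewrite eq_sym].
- by apply: le_trans (dP l ls lm); rewrite lerD.
- by apply: le_trans (IH l m ls ms lm); rewrite lerD.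
Qed.

Local Open Scope classical_set_scope.
Local Open Scope card_scope.
Local Open Scope ring_scope.

Theorem theorem6p1 (R : realType) (A : 'M[R]_4)
    (hp : `I_24 #<= pareto_spectrum A)
    (U : set 'M[R]_4) (hU : nbhs A U) :
  exists C : 'M[R]_4,
    [/\ U C, principally_simple C & pareto_spectrum A #<= pareto_spectrum C].
Proof.
have /finite_fsetP[X AX] := finite_pareto_spectrum A.
pose L := finmap.enum_fset X.
have XE : pareto_spectrum A = [set` L] by [].
have X24 : (24 <= size L)%N.
  have cX : pareto_spectrum A #= `I_(size L) by rewrite AX; exact/card_eq_fsetP.
  by move: hp; rewrite (card_le_eqr cX) card_le_II.
have inL l : l \in L -> pareto_eigenvalue A l.
  by move=> lL; have : [set` L] l by []; rewrite -XE.
have rep l : exists Jx : {set 'I_4} * 'cV[R]_4, l \in L -> minrep A l Jx.1 Jx.2.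
  case: (boolP (l \in L)) => lL; last by exists (finset.set0, 0).
  by have [J [x m]] := exists_minrep (inL l lL); exists (J, x).
have [Jx JxP] := boolp.choice rep.
have [e e0 sep] := separated_seq L.
have [C0 [UC0 rob]] := robust_approximation (finmap.fset_uniq X) e0 X24 JxP (nbhs_interior hU).
(* Stability holds on a neighborhood of [C0], so [C] can be taken principally simple inside it. *)
have nrob : \forall D \near C0, forall l, l \in L ->
    exists2 m, `|m - l| < e & pareto_eigenvalue D m.
  exact: near_all_seq rob.
have [C [[UC rC] sC]] := principally_simple_dense (filterI UC0 nrob).
exists C; split => //.
have fex l : exists m, l \in L -> `|m - l| < e /\ pareto_eigenvalue C m.
  case: (boolP (l \in L)) => lL; last by exists 0.
  by have [m ml pm] := rC l lL; exists m.
have [f fP] := boolp.choice fex.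
(* [f] picks a Pareto eigenvalue of [C] within [e] of each element of [L]; the separation makes it
   injective there. *)
have finj : {in pareto_spectrum A &, injective f}.
  move=> l m; rewrite !inE XE /= => lL mL flm; apply/eqP/negPn/negP => lm.
  have := sep l m lL mL lm; apply/negP; rewrite -ltNge.
  have -> : l - m = (f m - m) - (f l - l) by rewrite flm; ring.
  apply: le_lt_trans (ler_normB _ _) _; apply: ltrD.
    exact: (fP m mL).1.
  exact: (fP l lL).1.
rewrite -(card_le_eql (inj_card_eq finj)).
apply: subset_card_le => _ [l + <-]; rewrite XE /= => lL.
exact: (fP l lL).2.
Qed.
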